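(* Let $k$ be a field, $d\in\mathbb{N}$, and let $R=k[x_1,\dots,x_d]$ or $R=k[[x_1,\dots,x_d]]$. Let $\mathcal{B}$ be a basis of the free abelian group $\mathcal{P}(\mathbb{Z})_t$ consisting of translation classes of integral polytopes (rather than formal differences of such). Then for every $I\in ic(R)_{mon}$ there are $\underline{\alpha},\underline{\beta}\in\mathbb{N}^d$, elements $B_1,\dots,B_n,C_1,\dots,C_l\in\mathcal{B}$, and $m_1,\dots,m_n,p_1,\dots,p_l\in\mathbb{N}$ such that $$I=\overline{\underline{x}^{\underline{\beta}}\phi(B_1)^{m_1}\cdots\phi(B_n)^{m_n}}:\overline{\underline{x}^{\underline{\alpha}}\phi(C_1)^{p_1}\cdots\phi(C_l)^{p_l}}.$$
   Context: Notation: $\mathbb{N}$ includes $0$; $\mathbb{R}_+^d$ is the set of vectors in $\mathbb{R}^d$ with nonnegative coordinates; $\underline{x}^{\underline{\alpha}}=x_1^{\alpha_1}\cdots x_d^{\alpha_d}$; $\overline{I}$ is the integral closure of an ideal $I$; $H:K=\{r\in R : rK\subseteq H\}$ is the colon ideal; empty products of ideals equal $R$. $ic(R)_{mon}$ is the set of nonzero integrally closed monomial ideals of $R$. Let $P(\mathbb{Z})$ be the monoid of all (nonempty) polytopes in $\mathbb{R}^d$ with all vertices in $\mathbb{Z}^d$ (integral polytopes) under Minkowski addition. It is cancellative; let $\mathcal{P}(\mathbb{Z})$ be its Grothendieck group. $\mathcal{P}(\mathbb{Z})_t$ is the quotient of $\mathcal{P}(\mathbb{Z})$ obtained by identifying polytopes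 that are translates of one another by vectors of $\mathbb{Z}^d$; it is known to be a free abelian group having a basis of classes of polytopes. For the class $B=[P]$ of an integral polytope $P$, $\phi(B)$ denotes here the integrally closed monomial ideal $(\underline{x}^{\underline{\alpha}} : \underline{\alpha}\in(P_{\mathbb{N}}+\mathbb{R}_+^d)\cap\mathbb{N}^d)$ of $R$, where $P_{\mathbb{N}}$ is a chosen translate of $P$ with all vertices in $\mathbb{N}^d$; this ideal is well defined up to multiplication by monomials, and one fixes any choice of translate for each $B\in\mathcal{B}$. *)

(* Defs.v *)
From HB Require Import structures.
From mathcomp Require Import all_boot all_order all_algebra.
From mathcomp Require Import generic_quotient ring_quotient.
From mathcomp Require Import boolp classical_sets reals.
From mathcomp Require Import mpoly.

Set Implicit Arguments.
Unset Strict Implicit.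
Unset Printing Implicit Defensive.

Import Order.TTheory GRing.Theory Num.Theory.

Local Open Scope ring_scope.
Local Open Scope classical_set_scope.
Local Open Scope quotient_scope.

Record mpseries (n : nat) (k : comNzRingType) :=
  MPSeries { pscoef :> 'X_{1..n} -> k }.

HB.instance Definition _ n k := gen_eqMixin (mpseries n k).
HB.instance Definition _ n k := gen_choiceMixin (mpseries n k).

Section PowerSeries.
Variables (n : nat) (k : comNzRingType).
Implicit Types f g h : mpseries n k.

Lemma psP f g : (forall m, f m = g m) -> f = g.
Proof. by case: f g => [f] [g] /= fg; congr MPSeries; apply/funext. Qed.

Definition ps0 : mpseries n k := MPSeries (fun=> 0).
Definition psopp f : mpseries n k := MPSeries (fun m => - f m).
Definition psadd f g : mpseries n k := MPSeries (fun m => f m + g m).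

Definition psX (a : 'X_{1..n}) : mpseries n k :=
  MPSeries (fun m => (a == m)%:R).

(* The degree bound in the index type only makes the sum finite: a summand of
   m has degree at most that of m. *)
Definition psmul f g : mpseries n k := MPSeries (fun m =>
  \sum_(a : 'X_{1..n < (mdeg m).+1, (mdeg m).+1} | m == (a.1 + a.2)%MM)
    f a.1 * g a.2).

Lemma psaddA : associative psadd.
Proof. by move=> f g h; apply: psP => m /=; rewrite addrA. Qed.

Lemma psaddC : commutative psadd.
Proof. by move=> f g; apply: psP => m /=; rewrite addrC. Qed.

Lemma psadd0 : left_id ps0 psadd.
Proof. by move=> f; apply: psP => m /=; rewrite add0r. Qed.

Lemma psaddN : left_inverse ps0 psopp psadd.
Proof. by move=> f; apply: psP => m /=; rewrite addNr. Qed.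

HB.instance Definition _ :=
  GRing.isZmodule.Build (mpseries n k) psaddA psaddC psadd0 psaddN.

Definition pstrunc (e : nat) f : {mpoly k[n]} :=
  \sum_(m : 'X_{1..n < e}) f m *: 'X_[m].

Lemma pstruncE e f m : (mdeg m < e)%N -> (pstrunc e f)@_m = f m.
Proof. exact: mcoeff_mpoly. Qed.

Lemma psmulE f g m (p q : {mpoly k[n]}) :
  (forall a, (mdeg a <= mdeg m)%N -> f a = p@_a) ->
  (forall a, (mdeg a <= mdeg m)%N -> g a = q@_a) ->
  psmul f g m = (p * q)@_m.
Proof.
move=> fp gq; rewrite mcoeffM /=; apply: eq_bigr => -[[a ha] [b hb]] _ /=.
by rewrite fp ?gq.
Qed.

Lemma psmul_trunc e f g m : (mdeg m < e)%N ->
  psmul f g m = (pstrunc e f * pstrunc e g)@_m.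
Proof.
by move=> me; apply: psmulE => a am; rewrite pstruncE //; apply: leq_ltn_trans me.
Qed.

Lemma psmulA : associative psmul.
Proof.
move=> f g h; apply: psP => m; set e := (mdeg m).+1.
rewrite (@psmulE _ _ _ (pstrunc e f) (pstrunc e g * pstrunc e h)).
- rewrite (@psmulE _ _ _ (pstrunc e f * pstrunc e g) (pstrunc e h)) ?mulrA //.
  + by move=> a am; apply: psmul_trunc.
  + by move=> a am; rewrite pstruncE.
- by move=> a am; rewrite pstruncE.
- by move=> a am; apply: psmul_trunc.
Qed.

Lemma psmulC : commutative psmul.
Proof.
by move=> f g; apply: psP => m; rewrite !(@psmul_trunc (mdeg m).+1) // mulrC.
Qed.

Lemma psmul1 : left_id (psX 0%MM) psmul.
Proof.
move=> f; apply: psP => m.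
rewrite (@psmulE _ _ _ 1 (pstrunc (mdeg m).+1 f)) ?mul1r ?pstruncE //.
- by move=> a _; rewrite mcoeff1 eq_sym.
- by move=> a am; rewrite pstruncE.
Qed.

Lemma psmulDl : left_distributive psmul psadd.
Proof.
move=> f g h; apply: psP => m /=.
by rewrite -big_split; apply: eq_bigr => a _ /=; rewrite mulrDl.
Qed.

Lemma psX0_neq0 : psX 0%MM != 0.
Proof.
apply/eqP => /(congr1 (fun f : mpseries n k => f 0%MM)) /=.
by rewrite eqxx => /eqP; rewrite oner_eq0.
Qed.

HB.instance Definition _ := GRing.Zmodule_isComNzRing.Build (mpseries n k)
  psmulA psmulC psmul1 psmulDl psX0_neq0.

End PowerSeries.

Variant ring_kind := Polynomials | PowerSeries.

Definition base_ring (c : ring_kind) (k : fieldType) (d : nat) :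
    comNzRingType :=
  match c with
  | Polynomials => {mpoly k[d]}
  | PowerSeries => mpseries d k
  end.

Definition monom (c : ring_kind) (k : fieldType) (d : nat) (a : 'X_{1..d}) :
    base_ring c k d :=
  match c with
  | Polynomials => 'X_[a] : {mpoly k[d]}
  | PowerSeries => psX k a
  end.

Arguments monom c k {d} a.

Section Ideals.
Variable A : comNzRingType.
Implicit Types I J H K G : set A.

Definition is_ideal I : Prop :=
  [/\ I 0, forall r s, I r -> I s -> I (r + s) & forall a r, I r -> I (a * r)].

Definition ideal_gen G : set A := smallest is_ideal G.

Definition ideal_mul I J : set A :=
  ideal_gen [set z | exists r s, [/\ I r, J s & z = r * s]].

Definition ideal_exp I (n : nat) : set A := iter n (ideal_mul I) setT.

Definition ideal_scale (r : A) I : set A := [set r * s | s in I].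

Definition ideal_colon H K : set A := [set r | forall s, K s -> H (r * s)].

Definition int_closure I : set A :=
  [set r | exists (n : nat) (a : nat -> A),
     [/\ (0 < n)%N,
         forall i, (1 <= i <= n)%N -> ideal_exp I i (a i)
       & r ^+ n + \sum_(1 <= i < n.+1) a i * r ^+ (n - i) = 0]].

End Ideals.

Section MonomialIdeals.
Variables (c : ring_kind) (k : fieldType) (d : nat).

Definition is_monomial_ideal (I : set (base_ring c k d)) : Prop :=
  exists S : set 'X_{1..d}, I = ideal_gen (monom c k @` S).

Definition ic_mon (I : set (base_ring c k d)) : Prop :=
  [/\ is_monomial_ideal I, int_closure I = I & I <> [set 0]].

End MonomialIdeals.

Section Polytopes.
Variables (R : realType) (d : nat).
Implicit Types P Q : set 'rV[R]_d.

Definition hull (T : finType) (v : T -> 'rV[R]_d) : set 'rV[R]_d :=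
  [set x | exists a : T -> R,
     [/\ forall i, 0 <= a i, \sum_i a i = 1 & x = \sum_i a i *: v i]].

Definition polytope P : Prop :=
  P !=set0 /\ exists (n : nat) (v : 'I_n -> 'rV[R]_d), P = hull v.

Definition vertex P : set 'rV[R]_d :=
  [set x | P x /\ forall y z t, P y -> P z -> 0 < t < 1 ->
     x = t *: y + (1 - t) *: z -> y = x /\ z = x].

Definition int_vec (z : 'rV[int]_d) : 'rV[R]_d := map_mx intr z.

Definition nat_vec (a : 'X_{1..d}) : 'rV[R]_d := \row_i (a i)%:R.

Definition int_polytope P : Prop :=
  polytope P /\ vertex P `<=` range int_vec.

Definition minkowski P Q : set 'rV[R]_d :=
  [set x | exists y z, [/\ P y, Q z & x = y + z]].

Lemma hull_ord (T : finType) (v : T -> 'rV[R]_d) :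
  hull v = hull (fun i : 'I_#|T| => v (enum_val i)).
Proof.
apply/seteqP; split=> x [a [a0 a1 ->]].
- exists (fun i => a (enum_val i)); split=> //.
  + by rewrite -a1 [RHS](reindex _ (onW_bij _ (@enum_val_bij T))).
  + by rewrite [LHS](reindex _ (onW_bij _ (@enum_val_bij T))).
- exists (fun i => a (enum_rank i)); split=> //.
  + by rewrite -a1 [RHS](reindex _ (onW_bij _ (@enum_rank_bij T))).
  + rewrite [LHS](reindex _ (onW_bij _ (@enum_rank_bij T))).
    by apply: eq_bigr => i _; rewrite enum_rankK.
Qed.

Lemma minkowski_hull (T U : finType) (v : T -> 'rV[R]_d) (w : U -> 'rV[R]_d) :
  minkowski (hull v) (hull w) = hull (fun p : T * U => v p.1 + w p.2).
Proof.
apply/seteqP; split=> [x [_ [_ [[a [a0 a1 ->]] [b [b0 b1 ->]] ->]]]|].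
- exists (fun p => a p.1 * b p.2); split=> [p||].
  + exact: mulr_ge0.
  + rewrite -(pair_bigA _ (fun i j => a i * b j)) /= -{}a1.
    by apply: eq_bigr => i _; rewrite -mulr_sumr b1 mulr1.
  + rewrite -(pair_bigA _ (fun i j => (a i * b j) *: (v i + w j))) /=.
    under [RHS]eq_bigr => i _ do under eq_bigr => j _ do rewrite scalerDr.
    under [RHS]eq_bigr => i _ do rewrite big_split /=.
    rewrite big_split /=; congr (_ + _).
    * apply: eq_bigr => i _.
      by rewrite -scaler_suml -mulr_sumr b1 mulr1.
    * rewrite exchange_big /=; apply: eq_bigr => j _.
      by rewrite -scaler_suml -mulr_suml a1 mul1r.
- move=> x [a [a0 a1 ->]].
  exists (\sum_i (\sum_j a (i, j)) *: v i), (\sum_j (\sum_i a (i, j)) *: w j).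
  split.
  + exists (fun i => \sum_j a (i, j)); split=> // [i|].
      exact: sumr_ge0.
    by rewrite pair_bigA -[RHS]a1; apply: eq_bigr => -[].
  + exists (fun j => \sum_i a (i, j)); split=> // [j|].
      exact: sumr_ge0.
    by rewrite exchange_big pair_bigA -[RHS]a1; apply: eq_bigr => -[].
  + under eq_bigr do rewrite scalerDr.
    rewrite big_split /=; congr (_ + _).
    * under [RHS]eq_bigr do rewrite scaler_suml.
      by rewrite pair_bigA; apply: eq_bigr => -[].
    * under [RHS]eq_bigr do rewrite scaler_suml.
      by rewrite exchange_big pair_bigA; apply: eq_bigr => -[].
Qed.

Lemma minkowskiC : commutative minkowski.
Proof.
by move=> P Q; apply/seteqP; split=> x [y [z [Py Qz ->]]];
  exists z, y; rewrite addrC.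
Qed.

Lemma minkowskiA : associative minkowski.
Proof.
move=> P Q S; apply/seteqP; split=> x.
- move=> [y [_ [Py [z [t [Qz St ->]]] ->]]].
  by exists (y + z), t; rewrite addrA; split=> //; exists y, z.
- move=> [_ [t [[y [z [Py Qz ->]]] St ->]]].
  by exists y, (z + t); rewrite addrA; split=> //; exists z, t.
Qed.

Lemma minkowski0 : left_id [set 0] minkowski.
Proof.
move=> P; apply/seteqP; split=> x.
- by move=> [_ [z [-> Pz ->]]]; rewrite add0r.
- by move=> Px; exists 0, x; rewrite add0r.
Qed.

Lemma vertex_minkowski_l P Q y z : P y -> Q z ->
  vertex (minkowski P Q) (y + z) -> vertex P y.
Proof.
move=> Py Qz [_ xe]; split=> // u w t Pu Pw t01 yE.
have [] := xe (u + z) (w + z) t.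
- by exists u, z.
- by exists w, z.
- by [].
- by rewrite !scalerDr addrACA -yE -scalerDl (addrC t) subrK scale1r.
by move=> /addIr -> /addIr ->.
Qed.

Lemma int_polytope_minkowski P Q :
  int_polytope P -> int_polytope Q -> int_polytope (minkowski P Q).
Proof.
move=> [[[p Pp] [n [v PE]]] Pi] [[[q Qq] [m [w QE]]] Qi]; split.
  split; first by exists (p + q), p, q.
  by rewrite PE QE minkowski_hull hull_ord; do 2 eexists.
move=> x xV; have [[y [z [Py Qz xE]]] _] := xV; rewrite xE in xV *.
have /Pi [a _ <-] := vertex_minkowski_l Py Qz xV.
have [b _ <-] : range int_vec z.
  by apply: Qi; apply: (@vertex_minkowski_l _ P _ y); rewrite // minkowskiC addrC.
by exists (a + b) => //; rewrite /int_vec map_mxD.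
Qed.

Lemma int_polytope0 : int_polytope [set 0].
Proof.
split; last by move=> _ [-> _]; exists 0 => //; rewrite /int_vec map_mx0.
split; first by exists 0.
exists 1, (fun=> 0); apply/seteqP; split=> x.
- move=> ->; exists (fun=> 1); split=> //; first by rewrite big_ord1.
  by rewrite big_ord1 scaler0.
- by move=> [a [_ _ ->]]; rewrite big_ord1 scaler0.
Qed.

Record intPolytope :=
  IntPolytope { pset :> set 'rV[R]_d; psetP : int_polytope pset }.

Lemma pset_inj : injective pset.
Proof.
move=> [P Pi] [Q Qi] /= PQ; case: _ / PQ Qi => Qi.
by congr IntPolytope; exact: Prop_irrelevance.
Qed.

Definition poly_add (P Q : intPolytope) : intPolytope :=
  IntPolytope (int_polytope_minkowski (psetP P) (psetP Q)).

Definition poly_zero : intPolytope := IntPolytope int_polytope0.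

HB.instance Definition _ := gen_eqMixin intPolytope.
HB.instance Definition _ := gen_choiceMixin intPolytope.

Lemma poly_addA : associative poly_add.
Proof. by move=> P Q S; apply: pset_inj; exact: minkowskiA. Qed.

Lemma poly_addC : commutative poly_add.
Proof. by move=> P Q; apply: pset_inj; exact: minkowskiC. Qed.

Lemma poly_add0 : left_id poly_zero poly_add.
Proof. by move=> P; apply: pset_inj; exact: minkowski0. Qed.

HB.instance Definition _ :=
  GRing.isNmodule.Build intPolytope poly_addA poly_addC poly_add0.

Definition translate_of (P Q : set 'rV[R]_d) : Prop :=
  exists z : 'rV[int]_d, Q = [set x + int_vec z | x in P].

Definition nat_vertices (P : set 'rV[R]_d) : Prop :=
  vertex P `<=` range nat_vec.

Definition nonneg_orthant : set 'rV[R]_d := [set x | forall i, 0 <= x 0 i].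

End Polytopes.

Arguments int_vec R {d} z.
Arguments nat_vec R {d} a.
Arguments nonneg_orthant R d : clear implicits.

Section Grothendieck.
Variable M : nmodType.

Definition gro_rel (x y : M * M) : bool :=
  `[< exists s, x.1 + y.2 + s = y.1 + x.2 + s >].

Lemma gro_rel_refl : reflexive gro_rel.
Proof. by move=> x; apply/asboolP; exists 0. Qed.

Lemma gro_rel_sym : ssrbool.symmetric gro_rel.
Proof.
by move=> x y; apply/asboolP/asboolP => -[s sE]; exists s; rewrite sE.
Qed.

Lemma gro_rel_trans : transitive gro_rel.
Proof.
move=> y x z /asboolP[s sE] /asboolP[t tE]; apply/asboolP.
exists (y.1 + y.2 + s + t).
rewrite (AC (2*4) ((1*4*5)*(3*2*6))) /= sE tE.
by rewrite (AC (3*3) ((4*2)*(1*5*3*6))).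
Qed.

Canonical gro_equiv :=
  EquivRel gro_rel gro_rel_refl gro_rel_sym gro_rel_trans.
Canonical gro_encModRel := defaultEncModRel gro_rel.

Definition grothendieck := {eq_quot gro_rel}.

HB.instance Definition _ := Choice.on grothendieck.
HB.instance Definition _ := EqQuotient.on grothendieck.

Definition gro_zero : grothendieck := \pi_grothendieck (0, 0).
Definition gro_add := lift_op2 grothendieck
  (fun x y : M * M => (x.1 + y.1, x.2 + y.2)).
Definition gro_opp := lift_op1 grothendieck (fun x : M * M => (x.2, x.1)).

Lemma pi_gro_add : {morph \pi_grothendieck :
  x y / (x.1 + y.1, x.2 + y.2) >-> gro_add x y}.
Proof.
move=> x y; unlock gro_add; apply/eqmodP/asboolP => /=.
have /asboolP[s sE] : gro_rel x (repr (\pi_grothendieck x)).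
  by apply/eqmodP; rewrite reprK.
have /asboolP[t tE] : gro_rel y (repr (\pi_grothendieck y)).
  by apply/eqmodP; rewrite reprK.
set x' := repr _ in sE *; set y' := repr _ in tE *.
exists (s + t).
by rewrite (AC (2*2*2) ((1*3*5)*(2*4*6))) /= sE tE (AC (3*3) ((1*4)*(2*5)*(3*6))).
Qed.

Lemma pi_gro_opp : {morph \pi_grothendieck : x / (x.2, x.1) >-> gro_opp x}.
Proof.
move=> x; unlock gro_opp; apply/eqmodP/asboolP => /=.
have /asboolP[s sE] : gro_rel x (repr (\pi_grothendieck x)).
  by apply/eqmodP; rewrite reprK.
by exists s; rewrite [x.2 + _]addrC -sE [x.1 + _]addrC.
Qed.

Lemma gro_addA : associative gro_add.
Proof.
move=> x y z; rewrite -[x]reprK -[y]reprK -[z]reprK -!pi_gro_add /=.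
by rewrite !addrA.
Qed.

Lemma gro_addC : commutative gro_add.
Proof.
move=> x y; rewrite -[x]reprK -[y]reprK -!pi_gro_add /=.
by rewrite addrC [X in (_, X)]addrC.
Qed.

Lemma gro_add0 : left_id gro_zero gro_add.
Proof.
move=> x; rewrite -[x]reprK -!pi_gro_add /= !add0r.
by case: (repr x).
Qed.

Lemma gro_addN : left_inverse gro_zero gro_opp gro_add.
Proof.
move=> x; rewrite -[x]reprK -pi_gro_opp -pi_gro_add /=.
by apply/eqmodP/asboolP; exists 0 => /=; rewrite !addr0 add0r addrC.
Qed.

HB.instance Definition _ :=
  GRing.isZmodule.Build grothendieck gro_addA gro_addC gro_add0 gro_addN.

Definition gro_class (m : M) : grothendieck := \pi_grothendieck (m, 0).

End Grothendieck.

Section TranslationClasses.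
Variables (R : realType) (d : nat).

Definition is_subgroup (G : zmodType) (S : set G) : Prop :=
  S 0 /\ forall x y, S x -> S y -> S (x - y).

(* Identifying translates amounts to dividing by the subgroup generated by the
   differences of the classes of two translates. *)
Definition translation_subgroup : {pred grothendieck (intPolytope R d)} :=
  fun g => `[< smallest (@is_subgroup _)
    [set h | exists P Q : intPolytope R d,
       translate_of P Q /\ h = gro_class P - gro_class Q] g >].

Lemma translation_subgroup_closed : zmod_closed translation_subgroup.
Proof.
split; first by apply/asboolP => S [[S0 _] _].
move=> x y /asboolP xS /asboolP yS; apply/asboolP => S SG.
by have [[_ SB] _] := SG; apply: SB; [apply: xS | apply: yS].
Qed.

HB.instance Definition _ :=
  GRing.isZmodClosed.Build _ translation_subgroup translation_subgroup_closed.

Definition polytope_group_t : zmodType := Quotient.quot translation_subgroup.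

Definition polytope_class (P : intPolytope R d) : polytope_group_t :=
  \pi_(Quotient.quot translation_subgroup) (gro_class P).

End TranslationClasses.

Definition is_Zbasis (G : zmodType) (B : set G) : Prop :=
  (forall (s : seq G) (c : G -> int), uniq s -> (forall x, x \in s -> B x) ->
     \sum_(x <- s) x *~ c x = 0 -> forall x, x \in s -> c x = 0) /\
  (forall g : G, exists (s : seq G) (c : G -> int),
     (forall x, x \in s -> B x) /\ g = \sum_(x <- s) x *~ c x).

Definition phi (c : ring_kind) (k : fieldType) (R : realType) (d : nat)
    (P : set 'rV[R]_d) : set (base_ring c k d) :=
  ideal_gen (monom c k @`
    [set a | minkowski P (nonneg_orthant R d) (nat_vec R a)]).

Arguments phi c k {R d} P.

(* Main.v *)
Require Import Defs.
From HB Require Import structures.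
From mathcomp Require Import all_boot all_order all_algebra.
From mathcomp Require Import boolp classical_sets reals.
From mathcomp Require Import mpoly.
From mathcomp Require Import ring lra zify.

Set Implicit Arguments.
Unset Strict Implicit.
Unset Printing Implicit Defensive.

Import Order.TTheory GRing.Theory Num.Theory.

Local Open Scope ring_scope.
Local Open Scope classical_set_scope.

(** Let [P] be the convex hull of the exponents of finitely many monomial
generators of [I]. Expanding the class of [P] in the basis gives polytopes
[C] and [B], Minkowski sums of the chosen representatives, with
[P + C + alpha + S = B + beta + S] for some polytope [S]. An ideal squeezed
between the monomials of a lattice polytope [Q] and the elements supported in
[Q] + orthant has as integral closure exactly the elements supported in
[Q] + orthant, so the three ideals of the theorem are described by the
polyhedra of [P], [C + alpha] and [B + beta]; both inclusions then follow by
cancelling a polytope from an inclusion of Minkowski sums. *)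

(** Equality of classes only gives equality of polytopes after adding an unknown [S] and up to a
    shift in Z^d. The colon absorbs the negative coefficients: they are moved to the side of [P],
    where they form [C]; the shift is likewise split as [beta - alpha], because only monomials with
    natural exponents are available. The delicate point is the integral closure. That it is large
    enough is an integrality question: real convex weights must become rational before a power of a
    monomial can be placed in a power of the ideal. That it is not larger is a valuation argument,
    in which a total order compatible with the vector space structure, obtained by Zorn's lemma,
    takes the place of a linear functional supporting the polyhedron. Describing elements by their
    exponents treats polynomials and power series together; Dickson's lemma reduces infinite
    supports to finite sets. *)

(** * Convex sets and cancellation in Minkowski sums *)

Section Convex.
Variables (R : realType) (d : nat).
Local Notation V := 'rV[R]_d.
Local Notation orth := (nonneg_orthant R d).
Implicit Types (D P Q : set V).

Definition convex_set D : Prop :=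
  forall (T : finType) (a : T -> R) (x : T -> V),
    (forall i, 0 <= a i) -> \sum_i a i = 1 -> (forall i, D (x i)) ->
    D (\sum_i a i *: x i).

Lemma convex_hull (T : finType) (v : T -> V) : convex_set (hull v).
Proof.
move=> U a x a0 a1 /choice[b bP].
exists (fun j => \sum_i a i * b i j); split=> [j||].
- by apply: sumr_ge0 => i _; rewrite mulr_ge0 //; have [] := bP i.
- rewrite exchange_big -[RHS]a1; apply: eq_bigr => i _ /=.
  by rewrite -mulr_sumr; have [_ -> _] := bP i; rewrite mulr1.
- under [RHS]eq_bigr do rewrite scaler_suml.
  rewrite exchange_big; apply: eq_bigr => i _ /=.
  have [_ _ ->] := bP i.
  by rewrite scaler_sumr; apply: eq_bigr => j _; rewrite scalerA.
Qed.

Lemma convex_orthant : convex_set orth.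
Proof.
move=> T a x a0 _ x0 j; rewrite summxE; apply: sumr_ge0 => i _.
by rewrite mxE mulr_ge0 //; apply: x0.
Qed.

Lemma convex_minkowski P Q :
  convex_set P -> convex_set Q -> convex_set (minkowski P Q).
Proof.
move=> cP cQ T a x a0 a1 /choice[y] /choice[z] yzP.
exists (\sum_i a i *: y i), (\sum_i a i *: z i); split.
- by apply: cP => // i; have [] := yzP i.
- by apply: cQ => // i; have [] := yzP i.
- rewrite -big_split; apply: eq_bigr => i _ /=.
  by have [_ _ ->] := yzP i; rewrite scalerDr.
Qed.

Lemma hull_in (T : finType) (v : T -> V) t : hull v (v t).
Proof.
exists (fun i => (i == t)%:R); split=> [i||]; first exact: ler0n.
- by rewrite (bigD1 t) //= eqxx big1 ?addr0 // => i /negPf ->.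
- rewrite (bigD1 t) //= eqxx scale1r big1 ?addr0 // => i /negPf ->.
  by rewrite scale0r.
Qed.

Lemma hull_sub (T : finType) (v : T -> V) D :
  convex_set D -> (forall t, D (v t)) -> hull v `<=` D.
Proof. by move=> cD Dv x [a [a0 a1 ->]]; apply: cD. Qed.

(** The rows sum to 1, so [A - 1%:M] kills the constant column; its determinant is 0 and it also
    kills a nonzero row [v] from the left. The triangle inequality bounds [|v|] by [|v| A]
    entrywise; both have the same total, hence agree, and normalizing gives [p]. *)
Lemma stationary_distribution n (A : 'M[R]_n) :
  (0 < n)%N -> (forall i j, 0 <= A i j) -> (forall i, \sum_j A i j = 1) ->
  exists p : 'rV[R]_n, [/\ forall i, 0 <= p 0 i, \sum_i p 0 i = 1
    & p *m A = p].
Proof.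
move=> n0 A0 A1.
have /eqP/det0P[v v0] : \det (A - 1%:M) = 0.
  rewrite -det_tr; apply/eqP/det0P; exists (const_mx 1).
    apply/eqP => /rowP /(_ (Ordinal n0)) /eqP.
    by rewrite !mxE oner_eq0.
  apply: trmx_inj; rewrite trmx_mul trmxK trmx0 mulmxBl mul1mx.
  apply/colP => i; rewrite !mxE -[X in _ - X](A1 i); apply/eqP.
  by rewrite subr_eq0; apply/eqP/eq_bigr => j _; rewrite !mxE mulr1.
rewrite mulmxBr mulmx1 => /eqP; rewrite subr_eq0 => /eqP vA.
have le j : `|v 0 j| <= \sum_i `|v 0 i| * A i j.
  rewrite -{1}vA mxE (le_trans (ler_norm_sum _ _ _)) //.
  by apply: ler_sum => i _; rewrite normrM (ger0_norm (A0 _ _)).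
have eq j : \sum_i `|v 0 i| * A i j = `|v 0 j|.
  apply/eqP; rewrite -subr_eq0; apply/eqP.
  apply: (psumr_eq0P (P := predT) (F := fun j =>
    \sum_i `|v 0 i| * A i j - `|v 0 j|)) => // [i _|].
    by rewrite subr_ge0.
  rewrite big_split sumrN /= exchange_big /=; apply/eqP.
  rewrite subr_eq0; apply/eqP/eq_bigr => i _.
  by rewrite -mulr_sumr A1 mulr1.
pose S := \sum_i `|v 0 i|.
have S0 : 0 < S.
  rewrite lt_def sumr_ge0 ?andbT //; apply: contra v0 => /eqP.
  move=> /psumr_eq0P v0; apply/eqP/rowP => i; rewrite mxE.
  by apply/eqP; rewrite -normr_eq0; apply/eqP/v0.
exists (\row_i (`|v 0 i| / S)); split=> [i||].
- by rewrite mxE divr_ge0 // ltW.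
- by under eq_bigr do rewrite mxE; rewrite -mulr_suml divff // gt_eqF.
- apply/rowP => j; rewrite !mxE -eq mulr_suml; apply: eq_bigr => i _.
  by rewrite mxE mulrAC.
Qed.

(* Writing [a + v i] as a point of D plus a convex combination of the [v j]
   gives a stochastic matrix; averaging against a stationary distribution
   cancels the [v j], so no closedness of D is needed. *)
Lemma minkowski_cancel D (T : finType) (v : T -> V) a :
  convex_set D -> hull v !=set0 ->
  (forall x, hull v x -> minkowski D (hull v) (a + x)) -> D a.
Proof.
rewrite hull_ord; set n := #|T|; move: (fun i : 'I_n => _) => {}v.
move=> cD [x0 [a0 [_ sa0 _]]] Dv.
have n0 : (0 < n)%N.
  rewrite lt0n; apply/eqP => n0; move: v a0 Dv sa0; rewrite n0 => ? ? _.
  by rewrite big_ord0 => /esym /eqP; rewrite oner_eq0.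
have /choice[y] : forall i, exists y, exists A : 'I_n -> R, [/\ D y,
    forall j, 0 <= A j, \sum_j A j = 1 & a + v i = y + \sum_j A j *: v j].
  move=> i; have [y [z [Dy [b [b0 b1 ->]] E]]] := Dv _ (hull_in v i).
  by exists y, b.
move=> /choice[A AP].
have [||p [p0 p1 pA]] := @stationary_distribution _ (\matrix_(i, j) A i j) n0.
- by move=> i j; rewrite mxE; have [] := AP i.
- move=> i; under eq_bigr do rewrite mxE.
  by have [] := AP i.
suff -> : a = \sum_i p 0 i *: y i by apply: cD => // i; have [] := AP i.
apply: (addIr (\sum_i p 0 i *: v i)).
rewrite -[X in X + _]scale1r -{1}p1 scaler_suml -big_split /=.
under eq_bigr do rewrite -scalerDr.
transitivity (\sum_i p 0 i *: (y i + \sum_j A i j *: v j)).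
  by apply: eq_bigr => i _; have [_ _ _ ->] := AP i.
under [LHS]eq_bigr do rewrite scalerDr.
rewrite big_split /=; congr (_ + _).
under eq_bigr do rewrite scaler_sumr.
rewrite exchange_big; apply: eq_bigr => j _ /=.
rewrite -[in RHS]pA mxE scaler_suml; apply: eq_bigr => i _.
by rewrite mxE scalerA.
Qed.

End Convex.

(** * Pointed cones and total orders of the vector space *)

Section Cones.
Variables (R : realType) (d : nat).
Local Notation V := 'rV[R]_d.
Local Notation orth := (nonneg_orthant R d).
Implicit Types (C Q N : set V).

Definition pointed_cone C : Prop :=
  [/\ C 0, forall x y, C x -> C y -> C (x + y),
      forall a x, 0 <= a -> C x -> C (a *: x)
    & forall x, C x -> C (- x) -> x = 0].

(** If a maximal pointed cone above [C] missed both [u] and [- u], adjoining [u] would keep it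
    pointed, since a violation would put [- u] in it. Zorn's lemma is applied to the sets whose
    union with [C] is a pointed cone, so that the empty chain causes no trouble. *)
Lemma total_pointed_cone C : pointed_cone C ->
  exists Q, [/\ pointed_cone Q, C `<=` Q & forall x, Q x \/ Q (- x)].
Proof.
move=> Ccone; have [C0 _ _ _] := Ccone.
have [|A [Acone Amax]] := @Zorn_bigcup V (fun X => pointed_cone (C `|` X)).
  move=> F FP Ftot; set U := \bigcup_(X in F) X.
  have common x y : (C `|` U) x -> (C `|` U) y -> exists Z,
      [/\ pointed_cone Z, Z `<=` C `|` U, Z x & Z y].
    have sub X : F X -> C `|` X `<=` C `|` U.
      by move=> FX z [Cz|Xz]; [left | right; exists X].
    case=> [Cx|[X FX Xx]]; case=> [Cy|[Y FY Yy]].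
    - by exists C; split=> // z; left.
    - by exists (C `|` Y); split; [exact: FP|exact: sub|left|right].
    - by exists (C `|` X); split; [exact: FP|exact: sub|right|left].
    - have [XY|YX] := Ftot _ _ FX FY.
      + by exists (C `|` Y); split; [exact: FP|exact: sub|right; exact: XY|right].
      + by exists (C `|` X); split; [exact: FP|exact: sub|right|right; exact: YX].
  split=> [|x y Ux Uy|a x a0 Ux|x Ux Uy]; first by left.
  - by have [Z [[_ ZD _ _] ZU Zx Zy]] := common _ _ Ux Uy; apply/ZU/ZD.
  - by have [Z [[_ _ ZM _] ZU Zx _]] := common _ _ Ux Ux; apply/ZU/ZM.
  - by have [Z [[_ _ _ Z0] ZU Zx Zy]] := common _ _ Ux Uy; apply: Z0.
exists (C `|` A); split=> [//|x Cx|u]; first by left.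
have [A00 AD AM A0] := Acone.
apply: contrapT => /not_orP[nu nNu].
pose B := [set x | exists q s, [/\ (C `|` A) q, 0 <= s & x = q + s *: u]].
have CAB : C `|` A `<=` B.
  by move=> x Ax; exists x, 0; rewrite scale0r addr0; split.
apply: (Amax B).
  split; first by move=> x Ax; apply: CAB; right.
  move=> BA; apply: nu; right; apply: BA.
  by exists 0, 1; rewrite add0r scale1r; split.
rewrite setUidr; last by move=> x Cx; apply: CAB; left.
split; first exact: CAB.
- move=> _ _ [q [s [qA s0 ->]]] [r [t [rA t0 ->]]].
  exists (q + r), (s + t); rewrite addr_ge0 // scalerDl addrACA.
  by split=> //; apply: AD.
- move=> a _ a0 [q [s [qA s0 ->]]]; exists (a *: q), (a * s).
  by rewrite mulr_ge0 // scalerDr scalerA; split=> //; apply: AM.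
- move=> _ [q [s [qA s0 ->]]] [r [t [rA t0 E]]].
  have {}E : q + r = - ((s + t) *: u).
    by apply/eqP; rewrite -subr_eq0 opprK scalerDl addrACA -E subrr.
  have [st0|st0] := eqVneq (s + t) 0.
    have s00 : s = 0 by lra.
    move: E; rewrite st0 scale0r oppr0 s00 scale0r addr0 => /eqP.
    by rewrite addrC addr_eq0 => /eqP rq; apply: A0; rewrite -?rq.
  have st_gt0 : 0 < s + t by rewrite lt_def st0 addr_ge0.
  exfalso; apply: nNu; have -> : - u = (s + t)^-1 *: (q + r).
    by rewrite E scalerN scalerA mulVf // scale1r.
  by apply: AM; [rewrite invr_ge0 ltW|apply: AD].
Qed.

Lemma convex_set2 N x y a b : convex_set N -> 0 <= a -> 0 <= b -> a + b = 1 ->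
  N x -> N y -> N (a *: x + b *: y).
Proof.
move=> cN a0 b0 ab Nx Ny.
have := cN bool (fun i => if i then a else b) (fun i => if i then x else y).
by rewrite !big_bool /=; apply=> //; case.
Qed.

(** [Q] is the nonnegative cone of a total order in which [b] lies below [N]. It extends the cone
    spanned by [N - b] and the orthant; were that cone not pointed, convexity would exhibit [b] as a
    point of [N] plus a nonnegative vector, hence in [N]. *)
Lemma separating_order N b : convex_set N -> N !=set0 ->
  minkowski N orth `<=` N -> ~ N b ->
  exists Q, [/\ pointed_cone Q, forall x, Q x \/ Q (- x), orth `<=` Q
    & forall x, N x -> Q (x - b)].
Proof.
move=> cN [n0 Nn0] upN Nb.
pose C := [set x | exists a n o,
  [/\ 0 <= a, N n, orth o & x = a *: (n - b) + o]].
have orthD x y : orth x -> orth y -> orth (x + y).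
  by move=> x0 y0 i; rewrite mxE addr_ge0 ?x0 ?y0.
have orthM a x : 0 <= a -> orth x -> orth (a *: x).
  by move=> a0 x0 i; rewrite mxE mulr_ge0 ?x0.
have orth0 : orth 0 by move=> i; rewrite mxE.
have join a n a' n' : 0 < a + a' -> 0 <= a -> 0 <= a' -> N n -> N n' ->
    exists2 m, N m & a *: (n - b) + a' *: (n' - b) = (a + a') *: (m - b).
  move=> aa a0 a0' Nn Nn'.
  exists ((a / (a + a')) *: n + (a' / (a + a')) *: n').
    by apply: convex_set2 => //; rewrite ?divr_ge0 -?mulrDl ?divff ?gt_eqF // ltW.
  apply/rowP => i; rewrite !mxE; field; exact: lt0r_neq0.
have CC : pointed_cone C.
  split.
  - by exists 0, n0, 0; rewrite scale0r addr0; split.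
  - move=> _ _ [a [n [o [a0 Nn oo ->]]]] [a' [n' [o' [a0' Nn' oo' ->]]]].
    have [aa|aa] := eqVneq (a + a') 0.
      have [-> ->] : a = 0 /\ a' = 0 by split; lra.
      exists 0, n0, (o + o'); rewrite !scale0r !add0r; split=> //.
      exact: orthD.
    have aa0 : 0 < a + a' by rewrite lt_def aa addr_ge0.
    have [m Nm mE] := join _ _ _ _ aa0 a0 a0' Nn Nn'.
    exists (a + a'), m, (o + o'); rewrite addrACA mE; split=> //.
      exact: addr_ge0.
    exact: orthD.
  - move=> e _ e0 [a [n [o [a0 Nn oo ->]]]].
    exists (e * a), n, (e *: o); rewrite scalerDr scalerA mulr_ge0 //.
    by split=> //; apply: orthM.
  - move=> _ [a [n [o [a0 Nn oo ->]]]] [a' [n' [o' [a0' Nn' oo' E]]]].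
    have [aa|aa] := eqVneq (a + a') 0.
      have [z z'] : a = 0 /\ a' = 0 by split; lra.
      move: E; rewrite z z' !scale0r !add0r => /rowP E.
      apply/rowP => i; rewrite mxE; apply/eqP; rewrite eq_le oo andbT.
      by have := E i; have := oo' i; rewrite mxE; lra.
    have aa0 : 0 < a + a' by rewrite lt_def aa addr_ge0.
    have [m Nm mE] := join _ _ _ _ aa0 a0 a0' Nn Nn'.
    exfalso; apply: Nb; apply: upN.
    exists m, ((a + a')^-1 *: (o + o')); split=> //.
      by apply: orthM; [rewrite invr_ge0 ltW|apply: orthD].
    have : (a + a') *: (m - b) + (o + o') = 0.
      by rewrite -mE addrACA -E subrr.
    move/rowP => {}E; apply/rowP => i; move: (E i); rewrite !mxE => Ei.
    apply: (mulfI aa); rewrite mulrDr mulVKf //.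
    by lra.
have [Q [Qc CQ Qt]] := total_pointed_cone CC.
exists Q; split=> // [x xo|x Nx]; apply: CQ.
- by exists 0, n0, x; rewrite scale0r add0r.
- by exists 1, x, 0; rewrite scale1r addr0; split.
Qed.

End Cones.

(** * Dickson's lemma *)

Section Monomials.
Variable d : nat.
Local Notation mon := 'X_{1..d}.

(** Induction on the coordinates compared. Let [F] serve for the remaining ones and [b] bound its
    [i]-th entries: an [m] with [b <= m i] is dominated by [F] outright, and the others lie in
    finitely many slices [m i = j], each with its own list. *)
Lemma dickson_on (s : seq 'I_d) (S : set mon) : exists F : seq mon,
  (forall f, f \in F -> S f) /\
  forall m, S m -> exists2 f, f \in F & forall i, i \in s -> (f i <= m i)%N.
Proof.
elim: s S => [|i s IH] S.
  case: (pselect (S !=set0)) => [[m Sm]|S0].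
    by exists [:: m]; split=> [f /[1!inE] /eqP -> //|f _]; exists m; rewrite ?inE.
  by exists [::]; split=> // m Sm; case: S0; exists m.
have [F [FS Fle]] := IH S.
have /choice[G GP] := fun b : nat => IH [set m | S m /\ m i = b].
pose b := \max_(f <- F) f i.
exists (F ++ flatten [seq G j | j <- iota 0 b]); split=> [f|m Sm].
  rewrite mem_cat => /orP[/FS //|/flatten_mapP[j _ fG]].
  by have [/(_ _ fG)[]] := GP j.
have [bm|mb] := leqP b (m i).
  have [f fF fm] := Fle m Sm; exists f; first by rewrite mem_cat fF.
  move=> j /[1!inE] /orP[/eqP->|/fm //].
  by apply: leq_trans bm; rewrite /b (big_rem f) //= leq_maxl.
have [_ /(_ m (conj Sm erefl))[f fG fm]] := GP (m i).
exists f.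
  rewrite mem_cat; apply/orP; right; apply/flatten_mapP.
  by exists (m i) => //; rewrite mem_iota.
move=> j /[1!inE] /orP[/eqP->|/fm //].
by have [/(_ _ fG)[_ ->]] := GP (m i).
Qed.

Lemma dickson (S : set mon) : exists F : seq mon,
  (forall f, f \in F -> S f) /\
  forall m, S m -> exists2 f, f \in F & (f <= m)%MM.
Proof.
have [F [FS Fle]] := dickson_on (enum 'I_d) S; exists F; split=> // m Sm.
have [f fF fm] := Fle m Sm; exists f => //.
by apply/mnm_lepP => i; apply: fm; rewrite mem_enum.
Qed.

End Monomials.

(** * Rational weights and vertices of lattice polytopes *)

Section NatHulls.
Variables (R : realType) (d : nat).
Local Notation V := 'rV[R]_d.
Local Notation mon := 'X_{1..d}.
Local Notation orth := (nonneg_orthant R d).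

(** Dirichlet's pigeonhole argument: with one more multiple of [x] than there are boxes of side
    1/(N+1), two multiples have fractional parts in the same box, and [e] is the difference of their
    indices. *)
Lemma simultaneous_approximation (T : finType) (x : T -> R) (N : nat) :
  exists (e : nat) (k : T -> int),
    (0 < e)%N /\ forall t, `|e%:R * x t - (k t)%:~R| < N.+1%:R^-1.
Proof.
pose frac (j : nat) t := j%:R * x t - (Num.floor (j%:R * x t))%:~R.
have frac_itv j t : 0 <= frac j t < 1.
  have /andP[] := floor_itv (j%:R * x t).
  by rewrite intrD /frac => ? ?; apply/andP; split; lra.
have scaled_itv j t : 0 <= N.+1%:R * frac j t < N.+1%:R.
  have /andP[? ?] := frac_itv j t.
  by rewrite mulr_ge0 //= gtr_pMr.
pose box (j : 'I_(#|{ffun T -> 'I_N.+1}|.+1)) : {ffun T -> 'I_N.+1} :=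
  [ffun t => inord (Num.trunc (N.+1%:R * frac j t))].
have close i j t : box i = box j -> `|frac j t - frac i t| < N.+1%:R^-1.
  move=> /ffunP /(_ t); rewrite !ffunE => /(congr1 (@nat_of_ord _)).
  have inN l : (Num.trunc (N.+1%:R * frac l t) < N.+1)%N.
    have /andP[l0 lN] := scaled_itv l t; have /andP[le _] := truncn_itv l0.
    by rewrite -(ltr_nat R); apply: le_lt_trans lN.
  rewrite !inordK // => E.
  have /andP[i0 _] := scaled_itv i t; have /andP[j0 _] := scaled_itv j t.
  have /andP[] := truncn_itv i0; have /andP[] := truncn_itv j0.
  rewrite E; set l := Num.trunc _; rewrite -(natr1 l) => ? ? ? ?.
  have N0 : 0 < N.+1%:R :> R by rewrite ltr0n.
  rewrite -(ltr_pM2l N0) divff ?gt_eqF // -[X in X * _](gtr0_norm N0).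
  by rewrite -normrM ltr_norml; apply/andP; split; lra.
have [i [j [ij bij]]] : exists i j : 'I_(#|{ffun T -> 'I_N.+1}|.+1),
    (i < j)%N /\ box i = box j.
  apply: contrapT => no; have : injective box.
    move=> i j bij; apply/val_inj; have [ij|ij|//] := ltngtP i j.
    - by case: no; exists i, j.
    - by case: no; exists j, i.
  by move/leq_card; rewrite card_ord ltnn.
exists (j - i)%N, (fun t => Num.floor (j%:R * x t) - Num.floor (i%:R * x t)).
rewrite subn_gt0; split=> // t.
have := close _ _ t bij; rewrite /frac intrB natrB ?(ltnW ij) //.
by congr (`|_| < _); ring.
Qed.

(* The real weights are approximated simultaneously by fractions with a common
   denominator; the resulting errors are integers larger than [-1]. *)
Lemma hull_orthant_nat (T : finType) (u : T -> mon) (m : mon) :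
  minkowski (hull (fun t => nat_vec R (u t))) orth (nat_vec R m) ->
  exists (e : nat) (k : T -> nat), [/\ (0 < e)%N, (\sum_t k t = e)%N
    & forall i, (\sum_t k t * u t i <= e * m i)%N].
Proof.
move=> [_ [o [[a [a0 a1 ->]] oo mE]]].
(* Large enough for the three uses of [small]: with a Kronecker delta, with the constant 1, and with
   the [i]-th coordinates of the [u t]. *)
pose N := (#|T| + \sum_t \sum_i u t i)%N.
have [e [k [e0 ke]]] := simultaneous_approximation a N.
pose delta t : R := e%:R * a t - (k t)%:~R.
have dlt t : `|delta t| < N.+1%:R^-1 by apply: ke.
have small (c : T -> nat) : (\sum_t c t <= N)%N ->
    `|\sum_t delta t * (c t)%:R| < 1.
  move=> cN; apply: le_lt_trans (ler_norm_sum _ _ _) _.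
  apply: (@le_lt_trans _ _ (\sum_t N.+1%:R^-1 * (c t)%:R)).
    apply: ler_sum => t _; rewrite normrM normr_nat.
    by apply: ler_wpM2r => //; apply/ltW.
  rewrite -mulr_sumr -natr_sum mulrC ltr_pdivrMr // mul1r ltr_nat.
  by rewrite ltnS.
have k0 t : 0 <= k t.
  have := small (fun t' => (t' == t)%:R%N).
  have -> : (\sum_t0 (t0 == t)%:R%N = 1)%N.
    by rewrite (bigD1 t) //= eqxx big1 // => i /negPf ->.
  have -> : \sum_t0 delta t0 * ((t0 == t)%:R%N)%:R = delta t.
    rewrite (bigD1 t) //= eqxx mulr1 big1 ?addr0 // => i /negPf ->.
    by rewrite mulr0.
  have -> : (0 < N)%N by rewrite /N addn_gt0; apply/orP; left; apply/card_gt0P; exists t.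
  move=> /(_ isT) /ltr_normlW; rewrite /delta => lt.
  suff : -1 < k t by lia.
  rewrite -(ltr_int R); have : 0 <= e%:R * a t by rewrite mulr_ge0.
  by lra.
have kE t : (`|k t|%N)%:R = (k t)%:~R :> R by rewrite natr_absz ger0_norm.
have kdE t : (`|k t|%N)%:R = e%:R * a t - delta t by rewrite kE /delta opprB addrC subrK.
exists e, (fun t => `|k t|%N); split=> //.
- have := small (fun=> 1%N).
  rewrite sum1_card leq_addr => /(_ isT).
  have -> : \sum_t delta t * 1%:R = (e%:Z - (\sum_t `|k t|)%N%:Z)%:~R.
    rewrite rmorphB /= -!pmulrn natr_sum.
    under [in RHS]eq_bigr do rewrite kdE.
    rewrite sumrB -mulr_sumr a1 mulr1 subKr.
    by apply: eq_bigr => t _; rewrite mulr1.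
  by rewrite -intr_norm -[1]/(1%:~R) ltr_int; lia.
- move=> i; have := small (fun t => u t i).
  have -> : (\sum_t u t i <= N)%N.
    apply: leq_trans (leq_addl _ _); apply: leq_sum => t _.
    by rewrite (bigD1 i) //= leq_addr.
  move=> /(_ isT); have := oo i.
  have -> : \sum_t delta t * (u t i)%:R =
      e%:R * (m i)%:R - e%:R * o 0 i - (\sum_t `|k t| * u t i)%N%:R.
    rewrite natr_sum; under [in RHS]eq_bigr do rewrite natrM kdE mulrBl.
    have -> : (m i)%:R = \sum_t a t * (u t i)%:R + o 0 i.
      move/rowP: mE => /(_ i); rewrite !mxE summxE => ->; congr (_ + _).
      by apply: eq_bigr => t _; rewrite !mxE.
    rewrite mulrDr addrK sumrB mulr_sumr.
    under [X in _ = X - _]eq_bigr do rewrite mulrA.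
    by rewrite subKr.
  move=> o0 /ltr_normlP[lt1 _]; rewrite leqNgt; apply/negP => lt.
  have : ((e * m i).+1%:R <= (\sum_t `|k t| * u t i)%N%:R :> R) by rewrite ler_nat.
  rewrite -natr1 natrM; have : 0 <= e%:R * o 0 i by rewrite mulr_ge0.
  by lra.
Qed.

(** A generator whose weight is neither 0 nor 1 has [x] strictly between itself and the renormalized
    combination of the others, so extremality identifies it with [x]. *)
Lemma vertex_hull (T : finType) (v : T -> V) x :
  vertex (hull v) x -> exists t, x = v t.
Proof.
move=> [[a [a0 a1 xE]] xV].
have [t at0] : exists t, a t != 0.
  apply: contrapT => /forallNP az.
  have : \sum_t a t = 0 by apply: big1 => t _; apply/eqP/negPn/negP/az.
  by rewrite a1 => /eqP; rewrite oner_eq0.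
exists t; have sE : \sum_(i | i != t) a i = 1 - a t.
  by rewrite -a1 [X in _ = X - _](bigD1 t) //= addrAC subrr add0r.
have s0 : 0 <= \sum_(i | i != t) a i by apply: sumr_ge0.
have [at1|at1] := eqVneq (a t) 1.
  rewrite xE (bigD1 t) //= at1 scale1r big1 ?addr0 // => i it.
  have -> : a i = 0; last by rewrite scale0r.
  by move: i it; apply: psumr_eq0P => //; rewrite sE at1 subrr.
have at01 : 0 < a t < 1.
  by rewrite lt_def at0 a0 lt_def eq_sym at1 -subr_ge0 -sE.
have [/andP[tpos tlt1]] := at01.
have := xV (v t) (\sum_i ((i != t)%:R * a i / (1 - a t)) *: v i) _ _ _ at01.
case=> //; first exact: hull_in.
- exists (fun i => (i != t)%:R * a i / (1 - a t)); split=> // [i|].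
    by rewrite !mulr_ge0 // invr_ge0 subr_ge0 ltW.
  rewrite -mulr_suml (bigD1 t) //= eqxx mul0r add0r.
  under eq_bigr => i it do rewrite it mul1r.
  by rewrite sE divff // subr_eq0 eq_sym.
- rewrite xE (bigD1 t) //= scaler_sumr [in RHS](bigD1 t) //=.
  rewrite eqxx !mul0r scale0r scaler0 add0r; congr (_ + _).
  apply: eq_bigr => i it; rewrite it mul1r scalerA mulrC divfK //.
  by rewrite subr_eq0 eq_sym.
Qed.

(* A generating family of minimal size consists of vertices. *)
Lemma polytope_hull_vertices (P : set V) : polytope P ->
  exists (n : nat) (v : 'I_n -> V), P = hull v /\ forall i, vertex P (v i).
Proof.
move=> [P0 genP]; pose gen n := `[< exists v : 'I_n -> V, P = hull v >].
have exgen : exists n, gen n.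
  by have [n [v Pv]] := genP; exists n; apply/asboolP; exists v.
have [n /asboolP[v PE] minn] := ex_minnP exgen.
exists n, v; split=> // i; split; first by rewrite PE; apply: hull_in.
move=> y z t Py Pz /andP[t0 t1] viE.
move: Py Pz; rewrite {1 2}PE => -[a [a0 a1 yE]] [b [b0 b1 zE]].
pose c j := t * a j + (1 - t) * b j.
have c0 j : 0 <= c j by rewrite addr_ge0 // mulr_ge0 // ?subr_ge0 ltW.
have c1 : \sum_j c j = 1.
  by rewrite big_split -!mulr_sumr a1 b1 /= !mulr1 addrC subrK.
have vic : v i = \sum_j c j *: v j.
  rewrite viE yE zE !scaler_sumr -big_split; apply: eq_bigr => j _ /=.
  by rewrite !scalerA -scalerDl.
have sE : \sum_(j | j != i) c j = 1 - c i.
  by rewrite -c1 [X in _ = X - _](bigD1 i) //= addrAC subrr add0r.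
have s0 : 0 <= \sum_(j | j != i) c j by apply: sumr_ge0.
(* [c i] is a strict average of the weights [a i] and [b i], both at most 1; if it is 1, so are
   they, and [y] and [z] coincide with [v i]. *)
have [ci1|ci1] := eqVneq (c i) 1.
  have le1 (e : 'I_n -> R) : (forall j, 0 <= e j) -> \sum_j e j = 1 -> e i <= 1.
    by move=> e0 <-; rewrite (bigD1 i) //= lerDl sumr_ge0.
  have point (e : 'I_n -> R) : (forall j, 0 <= e j) -> \sum_j e j = 1 -> e i = 1 ->
      \sum_j e j *: v j = v i.
    move=> e0 e1 ei; rewrite (bigD1 i) //= ei scale1r big1 ?addr0 // => j ji.
    have -> : e j = 0; last by rewrite scale0r.
    move: j ji; apply: psumr_eq0P => //; apply: (addrI 1).
    by rewrite addr0 -[RHS]e1 [RHS](bigD1 i) //= ei.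
  have ai := le1 _ a0 a1; have bi := le1 _ b0 b1.
  by rewrite yE zE !point //; move: ci1; rewrite /c; nra.
exfalso; have n0 : (0 < n)%N := leq_ltn_trans (leq0n i) (ltn_ord i).
suff gn : gen n.-1 by have := minn _ gn; rewrite leqNgt prednK // leqnn.
apply/asboolP; exists (fun j => v (lift i j)).
have q0 : 1 - c i != 0 by rewrite subr_eq0 eq_sym.
apply/seteqP; rewrite PE; split.
  apply: hull_sub; first exact: convex_hull.
  move=> j; have [->|ji] := eqVneq j i; last first.
    by case: (unliftP i j) ji => [k ->|->]; rewrite ?eqxx // => _; apply: hull_in.
  have -> : v i = \sum_(k < n.-1) (c (lift i k) / (1 - c i)) *: v (lift i k).
    apply: (scalerI q0); rewrite scalerBl scale1r {1}vic.
    rewrite [X in X - _](bigD1_ord i) //= addrAC subrr add0r scaler_sumr.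
    by apply: eq_bigr => k _; rewrite scalerA mulrC divfK.
  exists (fun k => c (lift i k) / (1 - c i)); split=> // [k|].
    by rewrite divr_ge0 // -sE.
  rewrite -mulr_suml.
  have -> : \sum_(k < n.-1) c (lift i k) = 1 - c i.
    by rewrite -c1 [X in _ = X - _](bigD1_ord i) //= addrAC subrr add0r.
  by rewrite divff.
by apply: hull_sub; [exact: convex_hull|move=> k; exact: hull_in].
Qed.

Lemma hull_nat_vertices (P : set V) : polytope P -> nat_vertices P ->
  exists (n : nat) (u : 'I_n -> mon), P = hull (fun i => nat_vec R (u i)).
Proof.
move=> /polytope_hull_vertices[n [v [PE vP]]] natP.
have /choice[u uE] : forall i, exists a, v i = nat_vec R a.
  by move=> i; have [a _ <-] := natP _ (vP i); exists a.
by exists n, u; rewrite PE; congr hull; apply/funext.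
Qed.

Lemma int_polytope_hull_nat (T : finType) (u : T -> mon) : T ->
  int_polytope (hull (fun t => nat_vec R (u t))).
Proof.
move=> t; split.
  split; first by exists (nat_vec R (u t)); apply: hull_in.
  by rewrite hull_ord; do 2 eexists.
move=> x /vertex_hull[i ->]; exists (\row_j (u i j)%:Z) => //.
by apply/rowP => j; rewrite !mxE.
Qed.

End NatHulls.

(** * Integral closure of ideals through the Rees algebra *)

Section IntegralClosure.
Variable A : comNzRingType.
Implicit Types (G I J : set A) (r s : A).

Lemma ideal_gen_ideal G : is_ideal (ideal_gen G).
Proof.
split=> [I [[]]//|r s Gr Gs I IG|a r Gr I IG]; have [[_ ID IM] _] := IG.
- by apply: ID; [exact: (Gr I IG)|exact: (Gs I IG)].
- by apply: IM; exact: (Gr I IG).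
Qed.

Lemma ideal_gen_in G r : G r -> ideal_gen G r.
Proof. by move=> Gr I [_ GI]; apply: GI. Qed.

Lemma ideal_gen_sub G I : is_ideal I -> G `<=` I -> ideal_gen G `<=` I.
Proof. by move=> Ii GI r; apply; split. Qed.

Lemma ideal_mul_in I J r s : I r -> J s -> ideal_mul I J (r * s).
Proof. by move=> Ir Js; apply: ideal_gen_in; exists r, s. Qed.

Lemma ideal_mul_sub I J K : is_ideal K ->
  (forall r s, I r -> J s -> K (r * s)) -> ideal_mul I J `<=` K.
Proof. by move=> Ki IJ; apply: ideal_gen_sub => // _ [r [s [Ir Js ->]]]; apply: IJ. Qed.

Lemma is_idealT : is_ideal (@setT A). Proof. by []. Qed.

Lemma ideal_exp_ideal J n : is_ideal (ideal_exp J n).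
Proof. by case: n => [|n]; [exact: is_idealT|exact: ideal_gen_ideal]. Qed.

Lemma is_ideal_opp I r : is_ideal I -> I r -> I (- r).
Proof. by move=> [_ _ IM] Ir; rewrite -mulN1r; apply: IM. Qed.

Lemma is_ideal_sum I (T : Type) (l : seq T) (P : pred T) (F : T -> A) :
  is_ideal I -> (forall t, P t -> I (F t)) -> I (\sum_(t <- l | P t) F t).
Proof. by move=> [I0 ID _] FI; apply: big_ind. Qed.

Lemma ideal_expD J i j r s :
  ideal_exp J i r -> ideal_exp J j s -> ideal_exp J (i + j) (r * s).
Proof.
move=> Jr Js; elim: i r Jr => [r _|i IH r].
  by have [_ _] := ideal_exp_ideal J j; apply.
rewrite addSn => Jr; have [J0 JD JM] := ideal_exp_ideal J (i + j).+1.
suff : ideal_exp J i.+1 `<=` [set x | ideal_exp J (i + j).+1 (x * s)] by apply.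
apply: ideal_mul_sub; first split=> /=.
- by rewrite mul0r.
- by move=> x y; rewrite mulrDl; apply: JD.
- by move=> a x; rewrite -mulrA; apply: JM.
- by move=> x y Jx Jy /=; rewrite -mulrA; apply: ideal_mul_in => //; apply: IH.
Qed.

Lemma ideal_exp_expr J r n : J r -> ideal_exp J n (r ^+ n).
Proof. by move=> Jr; elim: n => // n IH; rewrite exprS; apply: ideal_mul_in. Qed.

(** The equation of integral dependence is T^n - r^n = 0. *)
Lemma int_closure_pow J r n :
  (0 < n)%N -> ideal_exp J n (r ^+ n) -> int_closure J r.
Proof.
move=> n0 Jr; exists n, (fun i => if i == n then - r ^+ n else 0); split=> // [i _|].
  case: eqP => [->|_]; first by apply: is_ideal_opp Jr; exact: ideal_exp_ideal.
  by have [] := ideal_exp_ideal J i.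
rewrite big_nat_recr //= eqxx subnn mulr1 big_nat big1 ?add0r ?subrr //.
by move=> i /andP[_ /ltn_eqF ->]; rewrite mul0r.
Qed.

Section Rees.
Variable J : set A.

Definition rees : {pred {poly A}} := fun p => `[< forall i, ideal_exp J i p`_i >].

Lemma rees_subring_closed : subring_closed rees.
Proof.
split=> [|p q /asboolP Jp /asboolP Jq|p q /asboolP Jp /asboolP Jq];
  apply/asboolP => i.
- by rewrite coef1; case: i => [|i] //; have [] := ideal_exp_ideal J i.+1.
- rewrite coefB; have Ji := ideal_exp_ideal J i; have [_ JD _] := Ji.
  by apply: JD => //; apply: is_ideal_opp.
- rewrite coefM; apply: is_ideal_sum => [|j _]; first exact: ideal_exp_ideal.
  by rewrite -[X in ideal_exp J X](subnKC (ltn_ord j : (j <= i)%N)); apply: ideal_expD.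
Qed.

HB.instance Definition _ := GRing.isSubringClosed.Build _ rees rees_subring_closed.

(** [integralOver] is relative to a ring morphism, so the Rees algebra becomes a ring of its own,
    with [rees_val] as inclusion. *)
Record rees_algebra := ReesAlgebra { rees_val : {poly A}; _ : rees_val \in rees }.

HB.instance Definition _ := [isSub for rees_val].
HB.instance Definition _ := [Choice of rees_algebra by <:].
HB.instance Definition _ := [SubChoice_isSubComNzRing of rees_algebra by <:].
HB.instance Definition _ := GRing.RMorphism.copy rees_val
  (\val : rees_algebra -> {poly A}).

Lemma rees_val_in (p : rees_algebra) i : ideal_exp J i (rees_val p)`_i.
Proof. by case: p => p /= /asboolP. Qed.

(* Integrality over an ideal becomes integrality over a ring, where sums are
   known to preserve it. *)
Lemma int_closure_rees r :
  int_closure J r <-> integralOver rees_val (r%:P * 'X).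
Proof.
split=> [[n [a [n0 Ja ra]]]|[p pmon proot]].
  (* The value 0 outside [1..n] gives membership for every [i], so the summands of [q] can be formed
     without a bound on the index. *)
  have memJ i : (if (1 <= i <= n)%N then a i else 0)%:P * 'X^i \in rees.
    apply/asboolP => j; rewrite coefCM coefXn.
    case: eqP => [->|_]; last by rewrite mulr0; have [] := ideal_exp_ideal J j.
    rewrite mulr1; case: ifP => [/Ja //|_].
    by have [] := ideal_exp_ideal J i.
  pose q := \sum_(1 <= i < n.+1) (ReesAlgebra (memJ i))%:P * 'X^(n - i).
  have qn : (size q < size ('X^n : {poly rees_algebra}))%N.
    rewrite size_polyXn ltnS; apply: (leq_trans (size_sum _ _ _)).
    apply/bigmax_leqP_seq => i; rewrite mem_index_iota => /andP[i1 _] _.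
    apply: (leq_trans (size_polyMleq _ _)); rewrite size_polyXn addnS /=.
    apply: (leq_trans (leq_add (size_polyC_leq1 _) (leqnn _))).
    by rewrite add1n ltn_subrL i1.
  exists ('X^n + q); first by rewrite monicE lead_coefDl // lead_coefXn.
  rewrite /root rmorphD /= hornerD map_polyXn hornerXn rmorph_sum horner_sum.
  have -> : \sum_(1 <= i < n.+1)
      (map_poly rees_val ((ReesAlgebra (memJ i))%:P * 'X^(n - i))).[r%:P * 'X] =
      (\sum_(1 <= i < n.+1) a i * r ^+ (n - i))%:P * 'X^n.
    rewrite rmorph_sum mulr_suml; apply: eq_big_nat => i /andP[i1 i2].
    rewrite rmorphM /= map_polyC map_polyXn hornerM hornerC hornerXn /=.
    rewrite i1 -ltnS i2 /= exprMn -rmorphXn /= rmorphM /=.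
    by rewrite mulrACA -exprD subnKC.
  by rewrite exprMn -rmorphXn -mulrDl -rmorphD /= ra mul0r.
have p0 : (0 < (size p).-1)%N.
  rewrite -subn1 subn_gt0 ltnNge; apply/negP => /size1_polyC pC.
  move: pmon proot; rewrite pC monicE lead_coefC => /eqP ->.
  by rewrite rmorph1 /root hornerC oner_eq0.
pose n := (size p).-1.
(* Taking the coefficient of ['X^n] in p(rX) = 0 keeps, from the coefficient of degree [n - i], only
   its component of degree [i], which lies in the [i]-th power of [J]. *)
exists n, (fun i => (rees_val p`_(n - i))`_i); split=> [//|i _|].
  exact: rees_val_in.
move/eqP: proot => /(congr1 (fun q : {poly A} => q`_n)).
rewrite horner_coef coef0 size_map_poly_id0; last first.
  by rewrite (monicP pmon) rmorph1 oner_neq0.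
rewrite coef_sum polySpred ?monic_neq0 // -/n big_ord_recr /=.
have cE (j : nat) : (j <= n)%N -> ((map_poly rees_val p)`_j * (r%:P * 'X) ^+ j)`_n =
    (rees_val p`_j)`_(n - j) * r ^+ j.
  move=> jn; rewrite coef_map exprMn mulrA coefMXn ltnNge jn /=.
  by rewrite -rmorphXn coefMC.
rewrite cE // subnn -lead_coefE (monicP pmon) coef1 mul1r => pn0.
rewrite -[RHS]pn0 addrC; congr (_ + _).
rewrite big_add1 /= big_nat_rev /= big_mkord; apply: eq_bigr => j _.
by rewrite cE ?(ltnW (ltn_ord j)) // add0n subnSK // subKn // ltnW.
Qed.

End Rees.

Lemma int_closure_ideal J : is_ideal (int_closure J).
Proof.
split.
- apply: (@int_closure_pow _ _ 1) => //; rewrite expr1.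
  by have [] := ideal_exp_ideal J 1.
- move=> r s /int_closure_rees Jr /int_closure_rees Js; apply/int_closure_rees.
  by rewrite rmorphD mulrDl; apply: integral_add.
- move=> b r [n [a [n0 Ja ra]]]; exists n, (fun i => b ^+ i * a i); split=> // [i /Ja|].
    by have [_ _] := ideal_exp_ideal J i; apply.
  rewrite exprMn; have -> : \sum_(1 <= i < n.+1) b ^+ i * a i * (b * r) ^+ (n - i) =
      b ^+ n * \sum_(1 <= i < n.+1) a i * r ^+ (n - i).
    rewrite mulr_sumr; apply: eq_big_nat => i /andP[_ i2].
    by rewrite exprMn -(subnKC (i2 : (i <= n)%N)) exprD addKn; ring.
  by rewrite -mulrDr ra mulr0.
Qed.

End IntegralClosure.

(** * Coefficients and supports, for both rings at once *)

Section Support.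
Variables (c : ring_kind) (k : fieldType) (d : nat).
Local Notation A := (base_ring c k d).
Local Notation mon := 'X_{1..d}.
Local Notation X := (@monom c k d).
Implicit Types (r s : A) (m a b : mon).

(** A common interface: after the basic rules for coefficients and monomials, the two rings are told
    apart only when an element is written through the monomials of its support. *)
Definition mcoef : mon -> A -> k :=
  match c return mon -> base_ring c k d -> k with
  | Polynomials => fun m p => p@_m
  | PowerSeries => fun m f => f m
  end.

Lemma mcoefP r s : (forall m, mcoef m r = mcoef m s) -> r = s.
Proof. by rewrite /mcoef; case: c r s => r s rs; [apply/mpolyP|apply: psP]. Qed.

Lemma mcoef0 m : mcoef m 0 = 0.
Proof. by rewrite /mcoef; case: c => //; apply: mcoeff0. Qed.

Lemma mcoefD m r s : mcoef m (r + s) = mcoef m r + mcoef m s.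
Proof. by rewrite /mcoef; case: c r s => // r s; apply: mcoeffD. Qed.

Lemma mcoefM m r s : mcoef m (r * s) =
  \sum_(ab : 'X_{1..d < (mdeg m).+1, (mdeg m).+1} | m == (ab.1 + ab.2)%MM)
    mcoef ab.1 r * mcoef ab.2 s.
Proof. by rewrite /mcoef; case: c r s => // r s; apply: mcoeffM. Qed.

Lemma mcoef_monom m a : mcoef m (X a) = (a == m)%:R.
Proof. by rewrite /mcoef; case: c => //; apply: mcoeffX. Qed.

Lemma mcoef_sum m (T : Type) (l : seq T) (F : T -> A) :
  mcoef m (\sum_(t <- l) F t) = \sum_(t <- l) mcoef m (F t).
Proof. by apply: (big_morph _ (mcoefD m) (mcoef0 m)). Qed.

Lemma mcoefM_neq0 m r s : mcoef m (r * s) != 0 ->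
  exists a b, [/\ m = (a + b)%MM, mcoef a r != 0 & mcoef b s != 0].
Proof.
rewrite mcoefM => /eqP nz; apply: contrapT => no; apply: nz.
apply: big1 => -[a b] /= /eqP mE; apply/eqP; rewrite mulf_eq0.
apply: contra_notT no; rewrite negb_or => /andP[ar bs].
by exists a, b.
Qed.

(** Replaces multiplicativity of leading coefficients; it is applied to monomials and to the
    smallest exponent of a power. *)
Lemma mcoefM_unique a b r s :
  (forall a' b', (a' + b' = a + b)%MM -> mcoef a' r != 0 -> mcoef b' s != 0 ->
    a' = a /\ b' = b) ->
  mcoef (a + b)%MM (r * s) = mcoef a r * mcoef b s.
Proof.
move=> uniq_ab; rewrite mcoefM.
have ha : (mdeg a < (mdeg (a + b)).+1)%N by rewrite ltnS mdegD leq_addr.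
have hb : (mdeg b < (mdeg (a + b)).+1)%N by rewrite ltnS mdegD leq_addl.
rewrite (bigD1 (BMultinom ha, BMultinom hb)) //= big1 ?addr0 //.
move=> [a' b'] /= /andP[/eqP abE ne]; apply/eqP; rewrite mulf_eq0.
apply: contraNT ne; rewrite negb_or => /andP[ar bs].
have [aE bE] := uniq_ab _ _ (esym abE) ar bs.
by apply/eqP; congr pair; apply/val_inj.
Qed.

Lemma mcoef_monom_neq0 m a : (mcoef m (X a) != 0) = (m == a).
Proof. by rewrite mcoef_monom [m == a]eq_sym;
  case: (a == m); rewrite ?oner_eq0 ?eqxx. Qed.

Lemma monom0 : X 0%MM = 1.
Proof. by case: c => //; apply: mpolyX0. Qed.

Lemma monomD a b : X (a + b)%MM = X a * X b.
Proof.
apply: mcoefP => m; rewrite mcoef_monom.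
have [<-|ne] := eqVneq.
  rewrite mcoefM_unique => [|a' b' _]; first by rewrite !mcoef_monom !eqxx mulr1.
  by rewrite !mcoef_monom_neq0 => /eqP -> /eqP ->.
apply/esym/eqP; apply: contraNT ne => /mcoefM_neq0[a' [b' [-> ]]].
by rewrite !mcoef_monom_neq0 => /eqP -> /eqP ->.
Qed.

Lemma monomX a n : X (a *+ n)%MM = X a ^+ n.
Proof.
elim: n => [|n IH]; first by rewrite mulm0n monom0.
by rewrite mulmS monomD IH exprS.
Qed.

Lemma mcoef_mul_monom a m r : mcoef (m + a)%MM (r * X a) = mcoef m r.
Proof.
rewrite mcoefM_unique => [|m' a' E _].
  by rewrite mcoef_monom eqxx mulr1.
rewrite mcoef_monom_neq0 => /eqP aE; split=> //.
by move: E; rewrite aE => /addIm.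
Qed.

End Support.

(** Division by a monomial: [q] collects the terms divisible by it, shifted down. It removes one
    generator at a time from a Dickson list. *)
Lemma pseries_split (k : fieldType) (d : nat) (f : 'X_{1..d})
    (r : base_ring PowerSeries k d) :
  exists s q, r = s + q * monom PowerSeries k f /\
    forall m, mcoef m s = if (f <= m)%MM then 0 else mcoef m r.
Proof.
pose q : base_ring PowerSeries k d := MPSeries (fun m => mcoef (m + f)%MM r).
pose s : base_ring PowerSeries k d :=
  MPSeries (fun m => if (f <= m)%MM then 0 else mcoef m r).
exists s, q; split=> //; apply: mcoefP => m; rewrite mcoefD [mcoef m s]/=.
case: ifPn => fm.
  by rewrite add0r -{2}(submK fm) mcoef_mul_monom /= submK.
rewrite [X in _ + X](_ : _ = 0) ?addr0 //; apply/eqP.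
apply: contraNT fm => /mcoefM_neq0[a [b [-> _]]].
by rewrite mcoef_monom_neq0 => /eqP ->; apply: lem_addl.
Qed.

(* For power series the support is infinite, and Dickson's lemma gives the
   finitely many monomials needed to write [r] as a combination. *)
Lemma ideal_monomial_support (c : ring_kind) (k : fieldType) (d : nat)
    (K : set (base_ring c k d)) r :
  is_ideal K -> (forall m, mcoef m r != 0 -> K (monom c k m)) -> K r.
Proof.
case: c K r => K r [K0 KD KM] rK.
  rewrite [r]mpolyE big_seq; apply: is_ideal_sum => // m; rewrite mcoeff_msupp => rm.
  by rewrite -mul_mpolyC; apply: KM; apply: rK.
have [F [FK Fle]] := dickson [set m | mcoef m r != 0].
have {rK}FK f : f \in F -> K (monom PowerSeries k f) by move=> /FK /rK.
elim: F r Fle FK => [|f F IH] r rF FK.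
  have -> // : r = 0.
  apply: mcoefP => m; rewrite mcoef0; apply/eqP; apply: contraT => rm.
  by have [] := rF m rm.
have [s [q [rE sE]]] := pseries_split f r; rewrite rE.
apply: KD; last by apply: KM; apply: FK; rewrite inE eqxx.
apply: IH => [m|g gF]; last by apply: FK; rewrite inE gF orbT.
rewrite /mkset sE; case: ifPn; rewrite ?eqxx // => fm rm.
have [g] := rF m rm; rewrite inE => /orP[/eqP -> gm|gF gm]; last by exists g.
by rewrite gm in fm.
Qed.

(** * Integral closure and Newton polyhedra *)

Section SupportIn.
Variables (R : realType) (c : ring_kind) (k : fieldType) (d : nat).
Local Notation A := (base_ring c k d).
Local Notation mon := 'X_{1..d}.
Local Notation X := (@monom c k d).
Local Notation V := 'rV[R]_d.
Local Notation orth := (nonneg_orthant R d).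
Local Notation nv := (@nat_vec R d).
Implicit Types (N P Q : set V) (r s : A) (m a b : mon) (J : set A).

(** Serves as the integrally closed monomial ideal of a Newton polyhedron [N]; a condition on
    coefficients applies to infinite series without any generators. *)
Definition supp_in N : set A := [set r | forall m, mcoef m r != 0 -> N (nv m)].

Lemma nat_vecD a b : nv (a + b)%MM = nv a + nv b.
Proof. by apply/rowP => i; rewrite !mxE mnmDE natrD. Qed.

Lemma nat_vecMn a n : nv (a *+ n)%MM = n%:R *: nv a.
Proof. by apply/rowP => i; rewrite !mxE mulmnE natrM mulrC. Qed.

Lemma nat_vec_inj : injective nv.
Proof.
move=> a b /rowP ab; apply/mnmP => i; have /eqP := ab i.
by rewrite !mxE eqr_nat => /eqP.
Qed.

Lemma nat_vec_orthant a : orth (nv a).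
Proof. by move=> i; rewrite mxE. Qed.

Lemma orthant0 : orth 0.
Proof. by move=> i; rewrite mxE. Qed.

Lemma orthantD : minkowski orth orth = orth.
Proof.
apply/seteqP; split=> [_ [x [y [x0 y0 ->]]] i|x x0].
  by rewrite mxE addr_ge0 ?x0 ?y0.
by exists x, 0; rewrite addr0; split=> //; exact: orthant0.
Qed.

Lemma sub_minkowski_orthant Q : Q `<=` minkowski Q orth.
Proof. by move=> x Qx; exists x, 0; rewrite addr0; split=> //; exact: orthant0. Qed.

Lemma supp_in_sub N P : N `<=` P -> supp_in N `<=` supp_in P.
Proof. by move=> NP r rN m /rN /NP. Qed.

Lemma supp_in_ideal N : minkowski N orth `<=` N -> is_ideal (supp_in N).
Proof.
move=> upN; split=> [m|r s rN sN m|r s sN m].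
- by rewrite mcoef0 eqxx.
- rewrite mcoefD; have [->|/rN //] := eqVneq (mcoef m r) 0.
  by rewrite add0r => /sN.
- move=> /mcoefM_neq0[a [b [-> _ /sN Nb]]]; apply: upN.
  exists (nv b), (nv a); rewrite nat_vecD addrC; split=> //.
  exact: nat_vec_orthant.
Qed.

Lemma supp_in_monom N m : supp_in N (X m) <-> N (nv m).
Proof.
split=> [|Nm a]; last by rewrite mcoef_monom_neq0 => /eqP ->.
by apply; rewrite mcoef_monom_neq0.
Qed.

Lemma supp_inM N P r s :
  supp_in N r -> supp_in P s -> supp_in (minkowski N P) (r * s).
Proof.
move=> rN sP m /mcoefM_neq0[a [b [-> /rN Na /sP Pb]]].
by exists (nv a), (nv b); rewrite nat_vecD.
Qed.

(* If an exponent [b] of [r] is outside [N], a total order separating [b] from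
   [N] yields a minimal exponent [m0] of [r]; in an equation of integral
   dependence the term [r ^+ n] is then the only one involving [n * m0]. *)
Lemma int_closure_supp_in N J : convex_set N -> N !=set0 ->
  minkowski N orth `<=` N -> J `<=` supp_in N -> int_closure J `<=` supp_in N.
Proof.
move=> cN N0 upN JN r [n [a [n0 Ja ra]]] b rb; apply: contrapT => Nb.
have [Q [[Q0 QD QM Qp] Qt orthQ NQ]] := separating_order cN N0 upN Nb.
(* The strict order attached to [Q]. *)
pose Qpos x := Q x /\ x <> 0.
have QposD x y : Qpos x -> Q y -> Qpos (x + y).
  move=> [Qx x0] Qy; split=> [|/eqP]; first exact: QD.
  by rewrite addr_eq0 => /eqP xy; apply: x0; apply: Qp => //; rewrite xy opprK.
have NQpos x : N x -> Qpos (x - nv b).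
  move=> Nx; split; first exact: NQ.
  by move=> /eqP; rewrite subr_eq0 => /eqP xb; rewrite xb in Nx.
(* Exponents of [J] are strictly above [b], so those of its [i]-th power are above [i] times [b].
   The weak form carries the induction, the strict one the final contradiction. *)
have expQ i s : ideal_exp J i s -> forall e, mcoef e s != 0 -> Q (nv e - i%:R *: nv b)
    /\ ((0 < i)%N -> Qpos (nv e - i%:R *: nv b)).
  elim: i s => [|i IH] s.
    by split=> //; rewrite scale0r subr0; exact/orthQ/nat_vec_orthant.
  move=> Js e se; suff Qe : Qpos (nv e - i.+1%:R *: nv b) by have [] := Qe; split.
  pose K : set A := [set s | forall e, mcoef e s != 0 -> Qpos (nv e - i.+1%:R *: nv b)].
  suff : ideal_exp J i.+1 `<=` K by move=> /(_ s Js) /(_ e se).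
  apply: ideal_mul_sub; first split=> [f|x y Kx Ky f|x y Ky f].
  - by rewrite mcoef0 eqxx.
  - rewrite mcoefD; have [->|/Kx //] := eqVneq (mcoef f x) 0.
    by rewrite add0r => /Ky.
  - move=> /mcoefM_neq0[g [h [-> _ /Ky Qh]]].
    by rewrite nat_vecD -addrA addrC; apply: QposD => //; exact/orthQ/nat_vec_orthant.
  - move=> x y /JN xN /IH Qy f /mcoefM_neq0[g [h [-> /xN Ng /Qy[Qh _]]]].
    rewrite nat_vecD -natr1 scalerDl scale1r [_ *: _ + _]addrC opprD addrACA.
    by apply: QposD => //; apply: NQpos.
(* The order need not be a well-order. But every exponent is coordinatewise above a member of a
   finite Dickson list, hence above it for [Q], so the minimum of the list is a minimum of the whole
   support. *)
have [m0 [rm0 m0min]] : exists m0, mcoef m0 r != 0 /\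
    forall e, mcoef e r != 0 -> Q (nv e - nv m0).
  have [F [FS Fle]] := dickson [set m | mcoef m r != 0].
  have [f0 f0F _] := Fle b rb.
  have [m0 m0F m0min] : exists2 m0, m0 \in F & forall f, f \in F -> Q (nv f - nv m0).
    elim: (F) f0 f0F {FS Fle} => [|g G IH] f0; first by rewrite in_nil.
    case: G IH => [_ _|h G IH _].
      by exists g => [|f]; rewrite inE // => /eqP ->; rewrite subrr.
    have [|m0 m0G m0min] := IH h; first exact: mem_head.
    have [gm|mg] := Qt (nv g - nv m0).
      exists m0 => [|f]; first by rewrite inE m0G orbT.
      by rewrite inE => /orP[/eqP ->//|/m0min].
    rewrite opprB in mg; exists g => [|f]; first exact: mem_head.
    rewrite inE => /orP[/eqP ->|/m0min Qf]; first by rewrite subrr.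
    by rewrite -(subrKA (nv m0)); apply: QD.
  exists m0; split=> [|e re]; first exact: FS.
  have [f /m0min Qf fe] := Fle e re.
  rewrite -(subrKA (nv f)); apply: QD => //.
  by rewrite -{1}(submK fe) nat_vecD addrK; exact/orthQ/nat_vec_orthant.
have rXQ i e : mcoef e (r ^+ i) != 0 -> Q (nv e - i%:R *: nv m0).
  elim: i e => [|i IH] e.
    by rewrite scale0r subr0 => _; exact/orthQ/nat_vec_orthant.
  rewrite exprS => /mcoefM_neq0[f [g [-> /m0min Qf /IH Qg]]].
  rewrite nat_vecD -natr1 scalerDl scale1r [_ *: _ + _]addrC opprD addrACA.
  exact: QD.
have rXm0 i : mcoef (m0 *+ i)%MM (r ^+ i) = mcoef m0 r ^+ i.
  elim: i => [|i IH]; first by rewrite mulm0n !expr0 -monom0 mcoef_monom eqxx.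
  rewrite mulmS exprS mcoefM_unique ?IH -?exprS // => f g E /m0min Qf /rXQ Qg.
  have fE : f = m0.
    apply: nat_vec_inj; apply/eqP; rewrite -subr_eq0; apply/eqP/Qp => //.
    rewrite opprB; suff -> : nv m0 - nv f = nv g - i%:R *: nv m0 by [].
    apply/eqP; rewrite subr_eq addrAC eq_sym subr_eq addrC -nat_vecMn -!nat_vecD.
    by rewrite E.
  by split=> //; move: E; rewrite fE => /addmI.
have := congr1 (mcoef (m0 *+ n)%MM) ra.
rewrite mcoef0 mcoefD rXm0 mcoef_sum big_nat big1 ?addr0 => [/eqP|i /andP[i1 i2]].
  by rewrite expf_eq0 n0 (negPf rm0).
apply/eqP; apply: contrapT => /negP /mcoefM_neq0[f [g [E af /rXQ Qg]]].
have iN : (1 <= i <= n)%N by rewrite i1.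
have [_ /(_ i1) Qf] := expQ _ _ (Ja _ iN) _ af.
have Qb : Q (i%:R *: (nv b - nv m0)) by apply: QM => //; apply: m0min.
(* The sum of f - ib > 0, g - (n - i)m0 >= 0 and i(b - m0) >= 0 is positive, yet it equals f + g - n
   m0 = 0. *)
have := QposD _ _ (QposD _ _ Qf Qg) Qb; case=> _; apply.
have -> : nv f = n%:R *: nv m0 - nv g by rewrite -nat_vecMn E nat_vecD addrK.
have -> : n%:R = i%:R + (n - i)%:R :> R by rewrite -natrD subnKC.
by apply/rowP => j; rewrite !mxE; ring.
Qed.

(** With cleared denominators, [e] times [m] dominates a sum of [e] of the exponents [u t], so the
    [e]-th power of [X m] is in the [e]-th power of [J]. *)
Lemma monom_hull_int_closure J (T : finType) (u : T -> mon) m :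
  (forall t, J (X (u t))) ->
  minkowski (hull (fun t => nv (u t))) orth (nv m) -> int_closure J (X m).
Proof.
move=> Ju /hull_orthant_nat[e [l [e0 le um]]].
apply: (@int_closure_pow _ _ _ e) => //; rewrite -monomX.
pose w := (\sum_t u t *+ l t)%MM.
have wm : (w <= m *+ e)%MM.
  apply/mnm_lepP => i; rewrite mnm_sumE mulmnE mulnC; apply: leq_trans (um i).
  by rewrite leq_eqVlt; apply/orP; left; apply/eqP/eq_bigr => t _; rewrite mulmnE mulnC.
rewrite -(submK wm) monomD; have [_ _] := ideal_exp_ideal J e; apply.
rewrite -le /w; elim/big_ind2: _ => [//|n1 m1 n2 m2 |t _].
  by rewrite monomD; apply: ideal_expD.
by rewrite monomX; apply: ideal_exp_expr.
Qed.

Lemma supp_in_int_closure J (T : finType) (u : T -> mon) :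
  (forall t, J (X (u t))) ->
  supp_in (minkowski (hull (fun t => nv (u t))) orth) `<=` int_closure J.
Proof.
move=> Ju r rJ; apply: ideal_monomial_support => [|m /rJ].
  exact: int_closure_ideal.
exact: monom_hull_int_closure.
Qed.

End SupportIn.

(** * Ideals squeezed by a lattice polytope *)

Section Realizes.
Variables (R : realType) (c : ring_kind) (k : fieldType) (d : nat).
Local Notation A := (base_ring c k d).
Local Notation mon := 'X_{1..d}.
Local Notation X := (@monom c k d).
Local Notation V := 'rV[R]_d.
Local Notation orth := (nonneg_orthant R d).
Local Notation nv := (@nat_vec R d).
Implicit Types (P Q : set V) (r s : A) (m a b : mon) (J : set A).

(** Only a lower and an upper bound on [J]: both pass to products, powers and monomial multiples, so
    no monomial generators of a product of ideals have to be exhibited. *)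
Definition realizes J Q : Prop :=
  exists (T : finType) (u : T -> mon), [/\ Q = hull (fun t => nv (u t)), Q !=set0,
    forall t, J (X (u t)) & J `<=` supp_in (minkowski Q orth)].

Lemma minkowski_orthantD P Q :
  minkowski (minkowski P orth) (minkowski Q orth) = minkowski (minkowski P Q) orth.
Proof.
rewrite -minkowskiA [minkowski orth _]minkowskiC -minkowskiA orthantD.
by rewrite minkowskiA.
Qed.

Lemma minkowski_orthantK P :
  minkowski (minkowski P orth) orth `<=` minkowski P orth.
Proof. by rewrite -minkowskiA orthantD. Qed.

Lemma hull_point (v : V) : [set v] = hull (fun _ : unit => v).
Proof.
apply/seteqP; split=> [_ ->|x [a [_ a1 ->]]]; first exact: (hull_in (fun=> v) tt).
by rewrite -scaler_suml a1 scale1r.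
Qed.

Lemma int_closure_realizes J Q :
  realizes J Q -> int_closure J = supp_in (minkowski Q orth).
Proof.
move=> [T [u [QE [x Qx] Ju JQ]]]; apply/seteqP; split.
  apply: int_closure_supp_in JQ; last exact: minkowski_orthantK.
  - by rewrite QE; apply: convex_minkowski; [exact: convex_hull|exact: convex_orthant].
  - by exists x; apply: sub_minkowski_orthant.
by rewrite QE; apply: supp_in_int_closure.
Qed.

Lemma realizesT : realizes setT [set 0].
Proof.
have nv0 : nv 0%MM = 0 by apply/rowP => i; rewrite !mxE mnm0E.
exists unit, (fun=> 0%MM); split=> //; first by rewrite -hull_point nv0.
  by exists 0.
by move=> r _ m _; rewrite minkowski0; exact: nat_vec_orthant.
Qed.

Lemma realizes_mul J K P Q :
  realizes J P -> realizes K Q -> realizes (ideal_mul J K) (minkowski P Q).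
Proof.
move=> [T [u [PE [x Px] Ju JP]]] [U [v [QE [y Qy] Kv KQ]]].
exists (T * U)%type, (fun tu => u tu.1 + v tu.2)%MM; split.
- rewrite PE QE minkowski_hull; congr hull; apply/funext => tu.
  by rewrite nat_vecD.
- by exists (x + y), x, y.
- by move=> tu; rewrite monomD; apply: ideal_mul_in.
- apply: ideal_mul_sub; first exact/supp_in_ideal/minkowski_orthantK.
  by move=> r s /JP rP /KQ sQ; rewrite -minkowski_orthantD; apply: supp_inM.
Qed.

Lemma realizes_exp J (P : intPolytope R d) n :
  realizes J P -> realizes (ideal_exp J n) (P *+ n : intPolytope R d).
Proof.
by move=> JP; elim: n => [|n IH]; [exact: realizesT|rewrite mulrS; apply: realizes_mul].
Qed.

Lemma realizes_prod n (J : 'I_n -> set A) (P : 'I_n -> intPolytope R d) :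
  (forall i, realizes (J i) (P i)) ->
  realizes (\big[@ideal_mul _/setT]_(i < n) J i) (\sum_(i < n) P i : intPolytope R d).
Proof.
move=> JP; elim/big_ind2: _ => [|J1 P1 J2 P2|i _]; last exact: JP.
  exact: realizesT.
exact: realizes_mul.
Qed.

Lemma realizes_scale a J P :
  realizes J P -> realizes (ideal_scale (X a) J) (minkowski [set nv a] P).
Proof.
move=> [T [u [PE [x Px] Ju JP]]]; exists T, (fun t => a + u t)%MM; split.
- apply/seteqP; rewrite PE hull_point minkowski_hull; split; apply: hull_sub;
    try exact: convex_hull.
  + move=> p; rewrite -nat_vecD.
    exact: (hull_in (fun t => nv (a + u t)%MM) p.2).
  + move=> t; rewrite nat_vecD.
    exact: (hull_in (fun p : unit * T => nv a + nv (u p.2)) (tt, t)).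
- by exists (nv a + x), (nv a), x.
- by move=> t; rewrite monomD; exists (X (u t)).
- move=> _ [r /JP rP <-]; rewrite -minkowskiA; apply: supp_inM => //.
  by apply/supp_in_monom.
Qed.

Lemma realizes_phi (P : intPolytope R d) :
  nat_vertices P -> realizes (phi c k P) P.
Proof.
have [[P0 genP] _] := psetP P => natP.
have [n [u PE]] := hull_nat_vertices (conj P0 genP) natP.
exists 'I_n, u; split=> // [i|].
  apply: ideal_gen_in; exists (u i) => //=; apply: sub_minkowski_orthant.
  by rewrite PE; apply: (hull_in (fun i => nv (u i))).
apply: ideal_gen_sub; first exact/supp_in_ideal/minkowski_orthantK.
by move=> _ [a aP <-]; apply/supp_in_monom.
Qed.

Lemma ic_mon_realizes (I : set A) : ic_mon I ->
  exists P : intPolytope R d, realizes I P.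
Proof.
move=> [[S IE] Iic I0]; have [F [FS Fle]] := dickson S.
have I_ideal : is_ideal I by rewrite IE; apply: ideal_gen_ideal.
(* An empty Dickson list would leave [S] empty and make [I] zero. *)
have [f fF] : exists f, f \in F.
  apply: contrapT => noF; apply: I0; apply/seteqP; split; last first.
    by move=> _ ->; have [] := I_ideal.
  rewrite IE; apply: ideal_gen_sub; first split=> [//|r s /= -> ->|b r /= ->].
  - by rewrite addr0.
  - by rewrite mulr0.
  by move=> _ [m Sm <-]; have [g gF _] := Fle m Sm; case: noF; exists g.
pose u := tnth (in_tuple F).
have [i _] : exists i, u i = f by have /tnthP[i ->] : f \in in_tuple F by []; exists i.
exists (IntPolytope (int_polytope_hull_nat R u i)), 'I_(size F), u; split=> //=.
- by exists (nv (u i)); apply: (hull_in (fun i => nv (u i))).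
- move=> j; rewrite IE; apply: ideal_gen_in; exists (u j) => //.
  by apply: FS; apply: (mem_tnth j (in_tuple F)).
rewrite IE; apply: ideal_gen_sub; first exact/supp_in_ideal/minkowski_orthantK.
move=> _ [m Sm <-]; apply/supp_in_monom; have [g gF gm] := Fle m Sm.
have /tnthP[j gE] : g \in in_tuple F by [].
exists (nv (u j)), (nv (m - g)%MM); rewrite -nat_vecD; split.
- exact: (hull_in (fun i => nv (u i))).
- exact: nat_vec_orthant.
- by rewrite /u -gE addmC submK.
Qed.

(** One inclusion adds [S] to [P + C] and cancels it again. For the other, an exponent [m] of [r]
    satisfies [m + C] in [B + orth]; adding [S] turns [B + S] into [P + C + S], and [C + S] is
    cancelled in one go. *)
Lemma supp_in_colon (P B C S : set V) (T : finType) (u : T -> mon) :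
  convex_set P -> convex_set B -> C = hull (fun t => nv (u t)) -> C !=set0 ->
  polytope S -> minkowski (minkowski P C) S = minkowski B S ->
  supp_in (minkowski P orth) = ideal_colon (A := A)
    (supp_in (minkowski B orth)) (supp_in (minkowski C orth)).
Proof.
move=> cP cB CE [c0 C0] [[s0 S0] [n [v SE]]] PCS.
have cPo : convex_set (minkowski P orth).
  by apply: convex_minkowski => //; exact: convex_orthant.
have cBo : convex_set (minkowski B orth).
  by apply: convex_minkowski => //; exact: convex_orthant.
apply/seteqP; split=> [r rP s sC|r rBC m rm].
  have := supp_inM rP sC; apply: supp_in_sub; rewrite minkowski_orthantD.
  move=> x [y [o [PCy oo xE]]].
  apply: (@minkowski_cancel _ _ _ _ v) => //; first by rewrite -SE; exists s0.
  rewrite -SE => z Sz.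
  have [b [z' [Bb Sz' E]]] : minkowski B S (y + z) by rewrite -PCS; exists y, z.
  exists (b + o), z'; split=> //; first by exists b, o.
  by rewrite xE addrAC E addrAC.
(* Multiplying [r] by the monomial of [u t] moves its exponent [m] to [m + u t] without changing the
   coefficient; convexity passes from the [u t] to all of [C]. *)
have mC x : C x -> minkowski B orth (nv m + x).
  rewrite CE; move: x; apply: hull_sub => [U a x a0 a1 Bx|t].
    rewrite -[nv m]scale1r -a1 scaler_suml -big_split /=.
    by under eq_bigr do rewrite -scalerDr; apply: cBo.
  rewrite -nat_vecD; apply: (rBC (X (u t))); last by rewrite mcoef_mul_monom.
  apply/supp_in_monom; apply: sub_minkowski_orthant; rewrite CE.
  exact: (hull_in (fun t => nv (u t))).
have CSE : minkowski C S = hull (fun p : T * 'I_n => nv (u p.1) + v p.2).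
  by rewrite CE SE minkowski_hull.
apply: (minkowski_cancel (v := fun p : T * 'I_n => nv (u p.1) + v p.2) cPo);
  rewrite -CSE; first by exists (c0 + s0), c0, s0.
move=> _ [x [y [Cx Sy ->]]].
have [b [o [Bb oo E]]] := mC x Cx.
have : minkowski B S (b + y) by exists b, y.
rewrite -PCS -minkowskiA => -[p [z [Pp CSz E']]].
exists (p + o), z; split=> //; first by exists p, o.
by rewrite addrA E addrAC E' addrAC.
Qed.

End Realizes.

(** * Equality of classes in the polytope group *)

Section PolytopeClasses.
Variables (R : realType) (d : nat).
Local Notation polytopes := (intPolytope R d).
Local Notation iv := (@int_vec R d).
Implicit Types (X Y S : polytopes) (z : 'rV[int]_d).

Lemma gro_classD (M : nmodType) (x y : M) :
  gro_class (x + y) = gro_class x + gro_class y.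
Proof. by rewrite [RHS](esym (pi_gro_add _ _)) /= addr0. Qed.

Lemma gro_class_eq (M : nmodType) (x y : M) :
  gro_class x = gro_class y -> exists s, x + s = y + s.
Proof.
by move=> /eqmodP /asboolP[s]; rewrite /= !addr0 => xy; exists s.
Qed.

Lemma int_polytope_point z : int_polytope [set iv z].
Proof.
split; last by move=> _ [-> _]; exists z.
split; first by exists (iv z).
by rewrite hull_point hull_ord; do 2 eexists.
Qed.

Definition point z : polytopes := IntPolytope (int_polytope_point z).

Lemma pointD z z' : point (z + z') = point z + point z'.
Proof.
apply: pset_inj; apply/seteqP; split=> [_ ->|_ [_ [_ [-> -> ->]]]].
  by exists (iv z), (iv z'); rewrite /int_vec map_mxD.
by rewrite /= /int_vec map_mxD.
Qed.

Lemma translate_ofP X Y : translate_of X Y <-> exists z, Y = X + point z.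
Proof.
split=> -[z E]; exists z.
  apply: pset_inj; rewrite E; apply/seteqP; split=> [_ [x Xx <-]|_ [x [_ [Xx -> ->]]]].
    by exists x, (iv z).
  by exists x.
rewrite E; apply/seteqP; split=> [_ [x [_ [Xx -> ->]]]|_ [x Xx <-]].
  by exists x.
by exists x, (iv z).
Qed.

Lemma polytope_classD X Y :
  polytope_class (X + Y) = polytope_class X + polytope_class Y.
Proof. by rewrite /polytope_class gro_classD raddfD. Qed.

Lemma polytope_class0 : polytope_class (0 : polytopes) = 0.
Proof.
by apply: (addrI (polytope_class 0)); rewrite -polytope_classD !addr0.
Qed.

Lemma polytope_classMn X n : polytope_class (X *+ n) = polytope_class X *+ n.
Proof.
elim: n => [|n IH]; first by rewrite !mulr0n polytope_class0.
by rewrite !mulrS polytope_classD IH.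
Qed.

Lemma polytope_class_sum n (X : 'I_n -> polytopes) :
  polytope_class (\sum_(i < n) X i) = \sum_(i < n) polytope_class (X i).
Proof. exact: (big_morph _ polytope_classD polytope_class0). Qed.

(** Classes of lattice points already form a subgroup, and it contains the difference of the classes
    of any two translates. *)
Lemma translation_subgroup_point g :
  g \in @translation_subgroup R d -> exists z, g = gro_class (point z).
Proof.
have point0 : gro_class (point 0) = 0.
  by apply: (addrI (gro_class (point 0))); rewrite -gro_classD -pointD !addr0.
have pointB z z' :
    gro_class (point (z - z')) = gro_class (point z) - gro_class (point z').
  by apply/eqP; rewrite eq_sym subr_eq -gro_classD -pointD subrK.
move=> /asboolP /(_ [set g | exists z, g = gro_class (point z)]); apply.
split; first split=> [|_ _ [z ->] [z' ->]].
- by exists 0; rewrite point0.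
- by exists (z - z'); rewrite pointB.
- move=> _ [X [Y [/translate_ofP[z ->] ->]]]; exists (- z).
  by rewrite -[- z]sub0r pointB point0 gro_classD opprD addrA subrr.
Qed.

(** [z] comes from dividing by translations, [S] from the Grothendieck construction. *)
Lemma polytope_class_eq X Y : polytope_class X = polytope_class Y ->
  exists z S, X + S = Y + point z + S.
Proof.
move=> /eqP; rewrite -Quotient.idealrBE => /translation_subgroup_point[z].
move=> /eqP; rewrite subr_eq addrC -gro_classD => /eqP /gro_class_eq[S XYS].
by exists z, S.
Qed.

Lemma translate_class X Y : translate_of X Y -> polytope_class X = polytope_class Y.
Proof.
move=> XY; apply/eqP; rewrite -Quotient.idealrBE; apply/asboolP => S [_]; apply.
by exists X, Y.
Qed.

Lemma convex_intPolytope X : convex_set (pset X).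
Proof. by have [[_ [n [v ->]]] _] := psetP X; apply: convex_hull. Qed.

Lemma point_nat (a : 'X_{1..d}) :
  pset (point (\row_i (a i)%:Z)) = [set nat_vec R a].
Proof. by congr [set _]; apply/rowP => i; rewrite !mxE. Qed.

End PolytopeClasses.

(** * The decomposition of an integrally closed monomial ideal *)

Theorem mainTheorem7 (R : realType) (k : fieldType) (d : nat) (c : ring_kind)
    (Bs : set (polytope_group_t R d))
    (PN : polytope_group_t R d -> intPolytope R d)
    (I : set (base_ring c k d)) :
  is_Zbasis Bs ->
  (forall B, Bs B -> exists P : intPolytope R d, B = polytope_class P) ->
  (forall B, Bs B -> exists P : intPolytope R d,
     [/\ B = polytope_class P, translate_of P (PN B) & nat_vertices (PN B)]) ->
  ic_mon I ->
  exists (alpha beta : 'X_{1..d})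
         (n : nat) (B : 'I_n -> polytope_group_t R d) (m : 'I_n -> nat)
         (l : nat) (C : 'I_l -> polytope_group_t R d) (p : 'I_l -> nat),
    [/\ forall i, Bs (B i),
        forall j, Bs (C j)
      & I = ideal_colon
              (int_closure (ideal_scale (monom c k beta)
                 (\big[@ideal_mul _/setT]_(i < n)
                    ideal_exp (phi c k (PN (B i))) (m i))))
              (int_closure (ideal_scale (monom c k alpha)
                 (\big[@ideal_mul _/setT]_(j < l)
                    ideal_exp (phi c k (PN (C j))) (p j))))].
Proof.
  move=> [_ gen] _ natPN Iic.
  have [P0 IP0] := ic_mon_realizes R Iic.
  have [s [cf [sB P0E]]] := gen (polytope_class P0).
  pose B (i : 'I_(size s)) := tnth (in_tuple s) i.
  have BsB i : Bs (B i) by apply/sB/(mem_tnth i (in_tuple s)).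
  (* Positive and negative parts of the coefficients. Both families run over all of [s]; an exponent
     0 contributes the unit ideal. *)
  pose m i := `|Num.max (cf (B i)) 0|%N; pose p i := `|Num.max (- cf (B i)) 0|%N.
  have mp i : cf (B i) = (m i)%:Z - (p i)%:Z by rewrite /m /p; lia.
  have classPN i : B i = polytope_class (PN (B i)).
    by have [P [BE /translate_class <- _]] := natPN _ (BsB i).
  have [z [S XYS]] : exists z S, P0 + \sum_i PN (B i) *+ p i + S =
      \sum_i PN (B i) *+ m i + point R z + S.
    apply: polytope_class_eq; rewrite polytope_classD !polytope_class_sum P0E.
    rewrite (big_nth 0) big_mkord -big_split; apply: eq_bigr => i _ /=.
    rewrite !polytope_classMn -classPN /B (tnth_nth 0) /= -(tnth_nth 0 (in_tuple s)).
    by rewrite mp mulrzBr !pmulrn subrK.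
  (* Negative and positive parts of the shift [z], so that [z] is [beta - alpha]. *)
  pose alpha := [multinom `|Num.max (- z 0%R i) 0|%N | i < d].
  pose beta := [multinom `|Num.max (z 0%R i) 0|%N | i < d].
  have zE : \row_i (beta i)%:Z = z + \row_i (alpha i)%:Z :> 'rV[int]_d.
    by apply/rowP => i; rewrite !mxE !mnmE; move: (z 0 i) => w; lia.
  have real a (e : 'I_(size s) -> nat) : realizes
      (ideal_scale (monom c k a)
        (\big[@ideal_mul _/setT]_i ideal_exp (phi c k (PN (B i))) (e i)))
      (minkowski [set nat_vec R a] (\sum_i PN (B i) *+ e i : intPolytope R d)).
    apply/realizes_scale/realizes_prod => i; apply/realizes_exp/realizes_phi.
    by have [P [_ _]] := natPN _ (BsB i).
  exists alpha, beta, (size s), B, m, (size s), B, p; split=> //.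
  have [_ IcI _] := Iic.
  rewrite -{1}IcI (int_closure_realizes IP0) !(int_closure_realizes (real _ _)).
  have [T [u [CE C0 _ _]]] := real alpha p.
  apply: supp_in_colon CE C0 (psetP S).1 _; first exact: convex_intPolytope.
    by rewrite -point_nat; apply: convex_minkowski; exact: convex_intPolytope.
  rewrite -!point_nat.
  (* The set equation is an identity in the monoid of integral polytopes, where [point] turns the
     splitting of [z] into a sum. *)
  suff : P0 + (point R (\row_i (alpha i)%:Z) + \sum_i PN (B i) *+ p i) + S =
      point R (\row_i (beta i)%:Z) + \sum_i PN (B i) *+ m i + S.
    exact: (congr1 (@pset R d)).
  rewrite zE pointD [in RHS](AC (2*1*1) (3*1*4*2)) /= -XYS.
  by rewrite (AC (1*2*1) (1*3*4*2)) /=.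
Qed.
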